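(* As $\sigma\searrow1/2$, we have $$\Gamma_\sigma(N)\ge\exp\bigg(\big\{2\sqrt2+o(1)\big\}\sqrt{|\log(\sigma-1/2)|}\,\frac{(\log N)^{1-\sigma}}{(\log_2N)^\sigma}\bigg).$$ Explicitly: for every $\varepsilon>0$ there exists $\delta>0$ such that for every positive integer $N$ with $\log_2 N>0$ and every real $\sigma$ with $\frac12+\frac1{\log_2N}\le\sigma\le\frac12+\delta$, the inequality $\Gamma_\sigma(N)\ge\exp\Big((2\sqrt2-\varepsilon)\sqrt{|\log(\sigma-1/2)|}\,\frac{(\log N)^{1-\sigma}}{(\log_2N)^\sigma}\Big)$ holds.
   Context: Here $\log_2N=\log\log N$ (iterated natural logarithm). For a finite set $\mathcal M$ of positive integers, define the Gál-type sum $$S_\sigma(\mathcal M):=\sum_{m,n\in\mathcal M}\frac{\gcd(m,n)^\sigma}{\mathrm{lcm}(m,n)^\sigma},$$ and for a positive integer $N$ let $$\Gamma_\sigma(N):=\sup_{|\mathcal M|=N}\frac{S_\sigma(\mathcal M)}{N},$$ the supremum being over all sets $\mathcal M$ of $N$ positive integers. The notation $\sigma\searrow1/2$ means that $\sigma$ tends to $1/2$ from above subject to $\sigma\ge 1/2+1/\log_2N$, as $N\to\infty$ (so $N\to\infty$ is forced by $\sigma\to1/2$). *)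

(* Defs.v *)
From HB Require Import structures.
From mathcomp Require Import all_boot all_order all_algebra finmap.
From mathcomp Require Import all_classical all_reals all_analysis.

Set Implicit Arguments.
Unset Strict Implicit.
Unset Printing Implicit Defensive.

Import Order.TTheory GRing.Theory Num.Theory.
Local Open Scope classical_set_scope.
Local Open Scope ring_scope.

Definition gal_sum (R : realType) (sigma : R) (M : {fset nat}) : R :=
  \sum_(m <- M) \sum_(n <- M)
    ((gcdn m n)%:R `^ sigma / (lcmn m n)%:R `^ sigma).

Definition pos_sets (N : nat) : set {fset nat} :=
  [set M | #|` M|%fset = N /\ forall m, m \in M -> (0 < m)%N].

(* The supremum is taken in the extended reals so that no boundedness side
   condition is hidden in it; it is finite when 0 <= sigma. *)
Definition Gal (R : realType) (sigma : R) (N : nat) : \bar R :=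
  ereal_sup [set (gal_sum sigma M / N%:R)%:E | M in pos_sets N].

Definition loglog (R : realType) (x : R) : R := ln (ln x).

(* Main.v *)
(** Weigh the integers [prod_p p^(e_p)], [e_p] in {0,1,2}, by [prod_p x_p(e_p)]
with [x_p(1) = 1] and [x_p(0) = x_p(2) = f_p]: letting the exponents deviate on
both sides of 1 gives the constant [2 sqrt 2] instead of 2.  Both the norm and
the quadratic form of this weight factor over primes.  Rankin's trick discards
the integers of weight less than [1/N] (after normalization), so that at most
[N] remain; as the Gal kernel is positive semidefinite, the weighted form is, up
to a power of [ln N], attained on a single level set of the weight.
With [alpha = sigma - 1/2] and [L = ln N * loglog N], take [f_p] proportional to
[p^(-sigma) / u], where [p = L e^u] and [u] runs from [l = - ln alpha] to about
[alpha^(-1)].  Mertens' first theorem on geometric blocks of [u] gives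
[sum_p p^(-2 sigma) / u ~ l L^(-2 alpha) / loglog N], and the cost of the
support, the entropy of [f^2], is a constant times the same sum. *)

Require Import Defs.
From HB Require Import structures.
From mathcomp Require Import all_boot all_order all_algebra finmap.
From mathcomp Require Import all_classical all_reals all_analysis.
From mathcomp Require Import zify ring lra.

Set Implicit Arguments.
Unset Strict Implicit.
Unset Printing Implicit Defensive.

Import Order.TTheory GRing.Theory Num.Theory.
Local Open Scope classical_set_scope.
Local Open Scope ring_scope.

(** * Gal sums over finite sets *)

(** The constant comes from balancing gain against cost. Write [g_p = - ln f_p]. To first order a
    prime multiplies the quotient of form and norm by [exp (4 f_p p^(-sigma))], while it costs
    entropy [4 g_p f_p^2], whose total has to stay below [ln N]. A Lagrange multiplier makes [f_p]
    proportional to [p^(-sigma) / g_p], and [L] is the scale for which [g_p] is about [u / 2]. With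
    [f_p = sqrt c p^(-sigma) / u] and [A = sum_p p^(-2 sigma) / u], the cost is about [2 c A] and
    the gain [4 sqrt c A]; the choice [c A = (ln N) / 2] gives the gain [2 sqrt 2 sqrt (A ln N)].
    Deviation on one side only would halve both gain and cost, which leads to 2. The range of [u]
    carries the leading order of [A]: the integral of [1 / u] from 1 to [l] is only [ln l], and
    beyond [1 / alpha] the factor [p^(-2 alpha)] decays. *)

Lemma gal_sumU (R : realType) (sigma : R) (A B : {fset nat}) :
  [disjoint A & B]%fset ->
  gal_sum sigma A + gal_sum sigma B <= gal_sum sigma (A `|` B)%fset.
Proof.
move=> dAB; rewrite /gal_sum.
have split_sum (F : nat -> R) : \sum_(m <- (A `|` B)%fset) F m =
    \sum_(m <- A) F m + \sum_(m <- B) F m.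
  rewrite -big_cat; apply/perm_big/uniq_perm => [||x]; first exact: fset_uniq.
    rewrite cat_uniq !fset_uniq andbT/=; apply/hasPn => x xB.
    by apply/negP => xA; move/fdisjointP: dAB => /(_ x xA); rewrite xB.
  by rewrite mem_cat inE.
rewrite split_sum; apply: lerD; apply: ler_sum => m _;
  rewrite split_sum ?lerDl ?lerDr; apply: sumr_ge0 => n _;
  by rewrite divr_ge0// powR_ge0.
Qed.

Lemma gal_sum_ge0 (R : realType) (sigma : R) (A : {fset nat}) :
  0 <= gal_sum sigma A.
Proof.
by apply: sumr_ge0 => m _; apply: sumr_ge0 => n _; rewrite divr_ge0 ?powR_ge0.
Qed.

Lemma gal_sum_scale (R : realType) (sigma : R) (A : {fset nat}) (c : nat) :
  (0 < c)%N -> gal_sum sigma [fset (c * m)%N | m in A]%fset = gal_sum sigma A.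
Proof.
move=> c0; have inj : {in A &, injective (muln c)}.
  by move=> x y _ _ /eqP; rewrite eqn_pmul2l// => /eqP.
rewrite /gal_sum big_imfset//=; apply: eq_bigr => m _.
rewrite big_imfset//=; apply: eq_bigr => n _.
rewrite -muln_gcdr -muln_lcmr !natrM !powRM//.
by rewrite -mulf_div divff ?mul1r// gt_eqF// powR_gt0// ltr0n.
Qed.

Lemma fset_nat_bounded (A : {fset nat}) :
  exists2 b, (0 < b)%N & forall m, m \in A -> (m < b)%N.
Proof.
exists (\max_(m <- A) m).+1 => // m mA; rewrite ltnS.
by rewrite (big_fsetD1 m)//= leq_maxl.
Qed.

(** A dilation leaves the Gal sum unchanged. If the factor exceeds every element collected so far,
    the new copy is disjoint from the old ones, and the cross terms only help. *)
Lemma pos_sets_copies (R : realType) (sigma : R) (n r : nat) (A : {fset nat}) :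
  pos_sets n A ->
  exists2 B, pos_sets (r * n) B & r%:R * gal_sum sigma A <= gal_sum sigma B.
Proof.
move=> [cA A0]; elim: r => [|r [B [cB B0] SB]].
  exists fset0; last by rewrite mul0r gal_sum_ge0.
  by split; [rewrite cardfs0|move=> m; rewrite inE].
have [b b0 ltb] := fset_nat_bounded B.
have inj : {in A &, injective (muln b)}.
  by move=> x y _ _ /eqP; rewrite eqn_pmul2l// => /eqP.
have dBA : [disjoint B & [fset (b * m)%N | m in A]]%fset.
  apply/fdisjointP => m mB; apply/imfsetP => -[k /= kA mE].
  by have := ltb _ mB; rewrite mE ltnNge leq_pmulr// A0.
exists (B `|` [fset (b * m)%N | m in A])%fset.
- split; last first.
    move=> m; rewrite inE => /orP[/B0//|/imfsetP[k /= kA ->]].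
    by rewrite muln_gt0 b0 A0.
  have /eqP -> : #|` B `|` [fset (b * m)%N | m in A]|%fset
    == (#|` B| + #|` [fset (b * m)%N | m in A]%fset|)%N.
    by move: dBA; rewrite -leq_card_fsetU.
  by rewrite cB card_in_imfset//= cA mulSn addnC.
- apply: le_trans (gal_sumU sigma dBA).
  rewrite gal_sum_scale// -natr1 mulrDl mul1r; exact: lerD.
Qed.

Lemma pos_sets_extend (R : realType) (sigma : R) (n N : nat) (A : {fset nat}) :
  pos_sets n A -> (n <= N)%N ->
  exists2 B, pos_sets N B & gal_sum sigma A <= gal_sum sigma B.
Proof.
move=> AP /subnK <-; elim: (N - n)%N => [|k [B [cB B0] SB]].
  by exists A.
have [b b0 ltb] := fset_nat_bounded B.
have bB : b \notin B by apply/negP => /ltb; rewrite ltnn.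
exists (b |` B)%fset.
- split; first by rewrite cardfsU1 bB cB.
  by move=> m; rewrite !inE => /orP[/eqP ->|/B0].
- apply: le_trans SB _; apply: le_trans (gal_sumU _ _).
    by rewrite lerDr gal_sum_ge0.
  by rewrite fdisjoint1X.
Qed.

(** Take [N %/ n] dilated copies of [A] and pad with arbitrary integers. The factor 2 pays for
    rounding, as [N < 2 * (N %/ n) * n]. *)
Lemma Gal_ge (R : realType) (sigma : R) (n N : nat) (A : {fset nat}) :
  pos_sets n A -> (0 < n <= N)%N ->
  ((gal_sum sigma A / (2 * n%:R))%:E <= Gal sigma N)%E.
Proof.
move=> AP /andP[n0 nN].
have [B BP SB] := pos_sets_copies sigma (N %/ n) AP.
have [C CP SC] := pos_sets_extend sigma BP (leq_trunc_div N n).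
apply: (@le_trans _ _ (gal_sum sigma C / N%:R)%:E); last first.
  by apply: ereal_sup_ubound; exists C.
have N0 : (0 < N)%N by exact: leq_trans nN.
rewrite lee_fin ler_pdivrMr ?mulr_gt0 ?ltr0n//.
apply: (@le_trans _ _ ((N %/ n)%:R * gal_sum sigma A / N%:R * (2 * n%:R))); last first.
  by rewrite ler_wpM2r ?mulr_ge0// ler_wpM2r ?invr_ge0// (le_trans SB).
have -> : (N %/ n)%:R * gal_sum sigma A / N%:R * (2 * n%:R) =
   gal_sum sigma A * ((2 * (N %/ n) * n)%:R / N%:R).
  by rewrite !natrM; ring.
rewrite ler_peMr ?gal_sum_ge0// ler_pdivlMr ?ltr0n// mul1r ler_nat.
have := divn_eq N n; have := ltn_pmod N n0.
have : (0 < N %/ n)%N by rewrite divn_gt0.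
by nia.
Qed.

(** * Products of prime powers with exponents 0, 1, 2 *)

Definition level_num (T : finType) (p : T -> nat) (e : {ffun T -> 'I_3}) : nat :=
  (\prod_i p i ^ e i)%N.

Definition dist3 (a b : 'I_3) : nat := ((a - b) + (b - a))%N.

(** With [w i = p_i^(-sigma)] this is the Gal kernel between two such integers: the ratio of gcd to
    lcm is the product of the [p_i ^ - |e_i - e'_i|]. *)
Definition level_kernel (R : realType) (T : finType) (w : T -> R)
    (e e' : {ffun T -> 'I_3}) : R :=
  \prod_i w i ^+ dist3 (e i) (e' i).

Lemma prime_powers_coprime (T : finType) (p : T -> nat) (e e' : T -> nat) :
  injective p -> (forall i, prime (p i)) ->
  (forall i, (e i == 0) || (e' i == 0))%N ->
  coprime (\prod_i p i ^ e i) (\prod_i p i ^ e' i).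
Proof.
move=> pI pP ee'.
apply: (big_ind (coprime^~ _)); [exact: coprime1n| |].
  by move=> x y cx cy; rewrite coprimeMl cx.
move=> i _; apply: (big_ind (coprime _)); [exact: coprimen1| |].
  by move=> x y cx cy; rewrite coprimeMr cx.
move=> j _; have [->|ij] := eqVneq i j.
  by case/orP: (ee' j) => /eqP ->; rewrite expn0 ?coprime1n ?coprimen1.
apply: coprimeXl; apply: coprimeXr; rewrite prime_coprime// dvdn_prime2//.
by apply: contra_neq ij => /pI.
Qed.

Lemma level_num_split (T : finType) (p : T -> nat) (e e' : {ffun T -> 'I_3}) :
  level_num p e = ((\prod_i p i ^ minn (e i) (e' i)) * \prod_i p i ^ (e i - e' i))%N.
Proof.
rewrite -big_split /level_num/=; apply: eq_bigr => i _.
by rewrite -expnD; congr expn; lia.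
Qed.

Lemma level_num_gcd_lcm (T : finType) (p : T -> nat) (e e' : {ffun T -> 'I_3}) :
  injective p -> (forall i, prime (p i)) ->
  exists g : nat, [/\ (0 < g)%N, gcdn (level_num p e) (level_num p e') = g &
    lcmn (level_num p e) (level_num p e') =
      (g * \prod_i p i ^ dist3 (e i) (e' i))%N].
Proof.
move=> pI pP.
have p0 (f : T -> nat) : (0 < \prod_i p i ^ f i)%N.
  by apply: prodn_gt0 => i; rewrite expn_gt0 prime_gt0.
have cop : coprime (\prod_i p i ^ (e i - e' i)) (\prod_i p i ^ (e' i - e i)).
  by apply: prime_powers_coprime => // i; lia.
have E' : level_num p e' =
    ((\prod_i p i ^ minn (e i) (e' i)) * \prod_i p i ^ (e' i - e i))%N.
  rewrite (level_num_split p e' e); congr muln.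
  by apply: eq_bigr => i _; rewrite minnC.
have gE : gcdn (level_num p e) (level_num p e') =
    (\prod_i p i ^ minn (e i) (e' i))%N.
  by rewrite E' (level_num_split p e e') -muln_gcdr (eqP cop) muln1.
exists (\prod_i p i ^ minn (e i) (e' i))%N; split => //.
have /eqP := muln_lcm_gcd (level_num p e) (level_num p e').
rewrite gE {2}(level_num_split p e e') {2}E' mulnACA -mulnA.
rewrite [X in X == _]mulnC eqn_pmul2l// => /eqP ->; congr muln.
by rewrite -big_split/=; apply: eq_bigr => i _; rewrite -expnD.
Qed.

(** Equal values have equal gcd and lcm, so the cofactor [\prod_i p i ^ dist3 (e i) (e' i)] is 1 and
    every distance vanishes. *)
Lemma level_num_inj (T : finType) (p : T -> nat) :
  injective p -> (forall i, prime (p i)) -> injective (level_num p).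
Proof.
move=> pI pP e e' ee'; have [g [g0 gE lE]] := level_num_gcd_lcm e e' pI pP.
have lcmnn n : lcmn n n = n by apply/lcmn_idPl/dvdnn.
move: lE gE; rewrite ee' lcmnn gcdnn => -> /eqP.
rewrite -{2}[g]muln1 eqn_pmul2l// => /eqP P1.
apply/ffunP => i; apply/val_inj/eqP.
have : (p i ^ dist3 (e i) (e' i) %| 1)%N by rewrite -[X in (_ %| X)%N]P1 (bigD1 i)//= dvdn_mulr.
rewrite dvdn1 => H; have : dist3 (e i) (e' i) = 0%N.
  move: H (prime_gt1 (pP i)); case: (dist3 _ _) => // k.
  by rewrite expnS muln_eq1 => /andP[/eqP ->].
by rewrite /dist3 => D0; apply/eqP => /=; lia.
Qed.

Lemma powR_prod (R : realType) (I : finType) (F : I -> R) (r : R) :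
  (forall i, 0 <= F i) -> (\prod_i F i) `^ r = \prod_i F i `^ r.
Proof.
move=> F0; apply: (big_ind2 (fun a b => 0 <= a /\ a `^ r = b) _ _ _).2 => //.
- by rewrite powR1.
- by move=> x1 x2 y1 y2 [x0 <-] [y0 <-]; rewrite powRM// mulr_ge0.
Qed.

Lemma level_num_ratio (R : realType) (sigma : R) (T : finType) (p : T -> nat)
    (e e' : {ffun T -> 'I_3}) :
  injective p -> (forall i, prime (p i)) ->
  (gcdn (level_num p e) (level_num p e'))%:R `^ sigma /
  (lcmn (level_num p e) (level_num p e'))%:R `^ sigma =
  level_kernel (fun i => (p i)%:R `^ (- sigma)) e e'.
Proof.
move=> pI pP; have [g [g0 -> ->]] := level_num_gcd_lcm e e' pI pP.
have g0R : (g%:R : R) `^ sigma != 0 by rewrite gt_eqF// powR_gt0// ltr0n.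
rewrite natrM powRM// invfM mulrA divff// mul1r.
rewrite natr_prod -powRN powR_prod//; apply: eq_bigr => i _.
have -> : (p i ^ dist3 (e i) (e' i))%:R = (p i)%:R `^ (dist3 (e i) (e' i))%:R :> R.
  by rewrite powR_mulrn// natrX.
rewrite -powR_mulrn; last exact: powR_ge0.
by rewrite -!powRrM mulrC.
Qed.

(** With [tri_diag], the Cholesky data of the covariance matrix of a stationary first-order
    autoregressive process; the diagonal is nonnegative for [0 <= w <= 1]. *)
Definition tri_coef (R : realType) (w : R) (k a : 'I_3) : R :=
  if (k <= a)%N then w ^+ (a - k) else 0.
Definition tri_diag (R : realType) (w : R) (k : 'I_3) : R :=
  if (k == 0 :> nat) then 1 else 1 - w ^+ 2.

(* LDL^T factorisation of the 3x3 matrix w^|a-b|, which shows that the Gal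
   kernel is positive semidefinite. *)
Lemma tri_factor (R : realType) (w : R) (a b : 'I_3) :
  w ^+ dist3 a b = \sum_k tri_diag w k * (tri_coef w k a * tri_coef w k b).
Proof.
case: a => [[|[|[|//]]] ?]; case: b => [[|[|[|//]]] ?];
  by rewrite !big_ord_recl big_ord0 /tri_diag /tri_coef /dist3 /=
     ?subn0 ?add0n ?addn0 /bump /= ?subnn ?subSS ?subn0; ring.
Qed.

(** The one-prime factorisations are tensored: distributing the product over the sums again gives a
    diagonal form, indexed by exponent vectors. *)
Lemma level_kernel_factor (R : realType) (T : finType) (w : T -> R)
    (e e' : {ffun T -> 'I_3}) :
  level_kernel w e e' = \sum_(k : {ffun T -> 'I_3})
    (\prod_i tri_diag (w i) (k i)) *
    ((\prod_i tri_coef (w i) (k i) (e i)) * \prod_i tri_coef (w i) (k i) (e' i)).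
Proof.
rewrite /level_kernel; under eq_bigr do rewrite tri_factor.
rewrite (bigA_distr_bigA (fun i k => tri_diag (w i) k *
  (tri_coef (w i) k (e i) * tri_coef (w i) k (e' i)))).
by apply: eq_bigr => k _; rewrite !big_split.
Qed.

(** * From weights to sets *)

Lemma sqr_sum_le (R : realType) (T : nat) (a : 'I_T -> R) :
  (\sum_t a t) ^+ 2 <= T%:R * \sum_t a t ^+ 2.
Proof.
have -> : T%:R * \sum_t a t ^+ 2 =
    \sum_(t < T) \sum_(u < T) (a t ^+ 2 + a u ^+ 2) / 2.
  set S := \sum_t _.
  have inner t : \sum_(u < T) (a t ^+ 2 + a u ^+ 2) / 2 = (T%:R * a t ^+ 2 + S) / 2.
    by rewrite -mulr_suml big_split/= sumr_const card_ord mulr_natl.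
  rewrite (eq_bigr _ (fun t _ => inner t)) -mulr_suml big_split/=.
  rewrite sumr_const card_ord -mulr_sumr -/S -(mulr_natl S T).
  by move: (T%:R * S) => y; lra.
rewrite expr2 mulr_suml; apply: ler_sum => t _; rewrite mulr_sumr.
by apply: ler_sum => u _; have := sqr_ge0 (a t - a u); nra.
Qed.

(** Pigeonhole. One factor [T] of the square is inherited from Cauchy-Schwarz, the other is the
    price of selecting a single term. *)
Lemma exists_big_term (R : realType) (T : nat) (q : 'I_T -> R) (b : R) :
  0 < b -> b <= T%:R * \sum_t q t ->
  exists t, b <= T%:R ^+ 2 * q t.
Proof.
move=> b0 H; apply: contrapT => /forallNP small.
have T0 : (0 < T)%N by case: (T) q H {small} => // q; rewrite mul0r leNgt b0.
have TR : 0 < (T%:R : R) by rewrite ltr0n.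
suff : T%:R * \sum_t q t < b by rewrite ltNge H.
have : \sum_t q t < \sum_(t < T) b / T%:R ^+ 2.
  apply: ltr_sum; first by apply/hasP; exists (Ordinal T0); rewrite ?mem_index_enum.
  move=> t _; rewrite ltr_pdivlMr ?exprn_gt0// mulrC ltNge.
  by apply/negP; exact: small.
rewrite sumr_const card_ord -(ltr_pM2l TR) => /lt_le_trans -> //.
by rewrite le_eqVlt; apply/orP; left; rewrite -mulr_natl; apply/eqP; field; rewrite gt_eqF.
Qed.

(* Positive semidefiniteness lets one pass from a weighted quadratic form to
   its restriction to a level set of the weight, losing only the squared number
   of levels. *)
Lemma layer_set (R : realType) (E D : finType) (G : E -> E -> R)
    (d : D -> R) (C : D -> E -> R) (x : E -> R) (Z X : R) (M : pred E) :
  (forall m, 0 < x m) -> 0 < Z -> \sum_m x m ^+ 2 <= Z -> 0 <= X ->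
  (forall k, 0 <= d k) -> (forall m n, 0 <= G m n) ->
  (forall m n, G m n = \sum_k d k * (C k m * C k n)) ->
  (forall m, M m -> Z <= x m ^+ 2 * expR X) ->
  0 < \sum_(m | M m) \sum_(n | M n) x m * x n * G m n ->
  exists A : {set E}, [/\ (0 < #|A|)%N, #|A|%:R <= expR X &
    (\sum_(m | M m) \sum_(n | M n) x m * x n * G m n) /
      (expR 1 * (X + 1) ^+ 2 * Z) * #|A|%:R <=
    \sum_(m in A) \sum_(n in A) G m n].
Proof.
move=> x0 Z0 sumx X0 d0 G0 GE HM Q0.
set Q := \sum_(m | _) _ in Q0 *.
(* The levels are unit intervals of [v], minus the logarithm of the normalized squared weight. On
   [M] it lies in [[0, X]], so that [truncn X + 1] levels suffice. *)
pose v m := ln (Z / x m ^+ 2).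
have x20 m : 0 < x m ^+ 2 by rewrite exprn_gt0.
have ve m : x m ^+ 2 = Z * expR (- v m).
  rewrite expRN lnK; last by rewrite posrE divr_gt0.
  by field; rewrite !gt_eqF.
have xZ m : x m ^+ 2 <= Z.
  by apply: le_trans sumx; rewrite (bigD1 m)//= lerDl sumr_ge0// => i _; exact: sqr_ge0.
have v0 m : 0 <= v m by rewrite ln_ge0// ler_pdivlMr// mul1r.
have vX m : M m -> v m <= X.
  move=> /HM; rewrite ve -mulrA -expRD ler_pMr// -{1}expR0 ler_expR; lra.
pose T := (Num.truncn X).+1.
have tT m : M m -> (Num.truncn (v m) < T)%N.
  by move=> Mm; rewrite ltnS; apply/le_truncn/vX.
pose A (t : 'I_T) : {set E} := finset (fun m => M m && (Num.truncn (v m) == t)).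
have splitM (F : E -> R) : \sum_(m | M m) F m = \sum_t \sum_(m in A t) F m.
  rewrite (partition_big (fun m => inord (Num.truncn (v m)) : 'I_T) predT)//=.
  apply: eq_bigr => t _; apply: eq_bigl => m; rewrite inE.
  case Mm : (M m) => //=; rewrite -val_eqE/= inordK//; exact: tT.
pose q t := \sum_(m in A t) \sum_(n in A t) x m * x n * G m n.
have quadE (P : pred E) : \sum_(m | P m) \sum_(n | P n) x m * x n * G m n =
    \sum_k d k * (\sum_(m | P m) C k m * x m) ^+ 2.
  under eq_bigr => m _ do under eq_bigr => n _ do rewrite GE mulr_sumr.
  under eq_bigr => m _ do rewrite exchange_big/=.
  rewrite exchange_big/=; apply: eq_bigr => k _.
  rewrite expr2 mulr_suml mulr_sumr; apply: eq_bigr => m _.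
  rewrite !mulr_sumr; apply: eq_bigr => n _; ring.
(* The form is a nonnegative combination of squares of linear forms, by [quadE]; Cauchy-Schwarz over
   the levels applies to each square. *)
have QT : Q <= T%:R * \sum_t q t.
  rewrite /Q quadE /q.
  under [X in _ * X]eq_bigr => t _ do rewrite (quadE (mem (A t))).
  rewrite exchange_big/= mulr_sumr; apply: ler_sum => k _.
  rewrite -mulr_sumr [leRHS]mulrCA ler_wpM2l// splitM; exact: sqr_sum_le.
have [t qt] := exists_big_term Q0 QT.
have T0 : 0 < (T%:R : R) by rewrite ltr0n.
have TX : T%:R <= X + 1.
  by rewrite -natr1 lerD2r; have /andP[] := truncn_itv X0.
have tle m : m \in A t -> t%:R <= v m < t%:R + 1.
  by rewrite inE => /andP[_ /eqP <-]; have := truncn_itv (v0 m); rewrite -natr1.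
(* Markov's inequality: the squared weights sum to at most [Z], so at most [c] of them reach
   [Z / c]. *)
have cardle (c : R) : 0 < c -> (forall m, m \in A t -> Z <= x m ^+ 2 * c) ->
    #|A t|%:R <= c.
  move=> c0 Hc; rewrite -(ler_pM2r Z0).
  apply: (@le_trans _ _ (\sum_(m in A t) x m ^+ 2 * c)).
    rewrite mulr_natl -sumr_const; exact: ler_sum.
  rewrite -mulr_suml [leLHS]mulrC ler_wpM2l ?(ltW c0)//; apply: le_trans sumx.
  rewrite [leRHS](bigID (mem (A t)))/= lerDl; apply: sumr_ge0 => m _; exact: sqr_ge0.
have card1 : #|A t|%:R <= expR X.
  by apply: cardle => [|m]; rewrite ?expR_gt0// inE => /andP[/HM].
have card2 : #|A t|%:R <= expR (t%:R + 1 : R).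
  apply: cardle => [|m /tle/andP[_ vt]]; first exact: expR_gt0.
  rewrite ve -mulrA -expRD ler_pMr// -{1}expR0 ler_expR; lra.
have qS : q t <= expR (- t%:R) * Z * \sum_(m in A t) \sum_(n in A t) G m n.
  rewrite mulr_sumr; apply: ler_sum => m mA.
  rewrite mulr_sumr; apply: ler_sum => n nA; rewrite ler_wpM2r//.
  have le1 k : k \in A t -> x k ^+ 2 <= expR (- t%:R) * Z.
    move=> /tle/andP[tv _]; rewrite ve mulrC ler_wpM2r ?(ltW Z0)// ler_expR; lra.
  have := le1 _ mA; have := le1 _ nA; have := sqr_ge0 (x m - x n); nra.
have cardA0 : (0 < #|A t|)%N.
  rewrite lt0n; apply: contraTneq qt => /eqP; rewrite cards_eq0 => /eqP A0.
  by rewrite /q A0 big_set0 mulr0 -ltNge.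
exists (A t); split => //.
set S := \sum_(m in A t) _ in qS *.
have S0 : 0 <= S by apply: sumr_ge0 => m _; apply: sumr_ge0.
have X10 : 0 < X + 1 by lra.
rewrite mulrAC ler_pdivrMr ?mulr_gt0 ?expR_gt0 ?exprn_gt0//.
(* On level [t] the squared weights are at most [Z e^(-t)] and the cardinality is at most [e^(t+1)];
   the product leaves the factor [expR 1] of the conclusion. *)
apply: (@le_trans _ _ ((X + 1) ^+ 2 * (expR (- t%:R) * Z * S) * expR (t%:R + 1 : R))).
  apply: ler_pM => //; first exact: ltW.
  apply: (le_trans qt); apply: ler_pM => //.
  - by apply: sumr_ge0 => m _; apply: sumr_ge0 => n _; rewrite !mulr_ge0// ltW.
  - by rewrite lerXn2r// nnegrE ltW.
rewrite [leLHS](_ : _ = (X + 1) ^+ 2 * Z * S * (expR (- t%:R) * expR (t%:R + 1))); last by ring.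
rewrite -expRD addKr le_eqVlt; apply/orP; left; apply/eqP; ring.
Qed.

Lemma ffun_pair_sum (R : realType) (T J : finType) (F : T -> J -> J -> R) :
  \sum_(m : {ffun T -> J}) \sum_(n : {ffun T -> J}) \prod_i F i (m i) (n i) =
  \prod_i \sum_a \sum_b F i a b.
Proof.
rewrite (bigA_distr_bigA (fun i a => \sum_b F i a b)); apply: eq_bigr => m _.
by rewrite (bigA_distr_bigA (fun i b => F i (m i) b)).
Qed.

Definition level_weight (R : realType) (f : R) (a : 'I_3) : R :=
  if (a == 1 :> nat) then 1 else f.

Lemma level_weight_gt0 (R : realType) (f : R) a : 0 < f -> 0 < level_weight f a.
Proof. by rewrite /level_weight; case: ifP. Qed.

Lemma sum_level_sqr (R : realType) (f : R) :
  \sum_a level_weight f a ^+ 2 = 1 + 2 * f ^+ 2.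
Proof. by rewrite !big_ord_recl big_ord0 /level_weight /=; ring. Qed.

(** The two weights are kept distinct because Rankin's tail pairs [g = f^(1 - 2s)] on one side with
    [f] on the other; [g = f] gives the local factor of the full form. *)
Lemma sum_level_pair (R : realType) (f g w : R) :
  \sum_a \sum_b level_weight g a * level_weight f b * w ^+ dist3 a b =
  1 + 2 * f * w + 2 * g * (w + f + f * w ^+ 2).
Proof.
by rewrite !big_ord_recl !big_ord0 /level_weight /dist3 /= /bump /=
  ?subn0 ?add0n ?addn0 ?subnn ?subSS ?subn0; ring.
Qed.

(* The weight of the numbers whose exponents deviate from 1 too often is
   controlled by Rankin's trick, with exponent [s]. *)
Lemma Gal_ge_product (R : realType) (sigma : R) (T : finType) (p : T -> nat)
    (f : T -> R) (s : R) (N : nat) :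
  injective p -> (forall i, prime (p i)) -> (forall i, 0 < f i) ->
  0 < sigma -> 0 <= s -> (0 < N)%N ->
  let w i := (p i)%:R `^ (- sigma) in
  let Z := \prod_i (1 + 2 * f i ^+ 2) in
  let Q := \prod_i (1 + 2 * f i * w i + 2 * f i * (w i + f i + f i * w i ^+ 2)) in
  4 * ((Z / N%:R) `^ s *
    \prod_i (1 + 2 * f i * w i +
             2 * f i `^ (1 - 2 * s) * (w i + f i + f i * w i ^+ 2))) <= Q ->
  ((Q / (4 * expR 1 * (ln (N%:R : R) + 1) ^+ 2 * Z))%:E <= Gal sigma N)%E.
Proof.
move=> pI pP f0 sg0 s0 N0 w Z Q tail.
have w0 i : 0 < w i by rewrite powR_gt0// ltr0n prime_gt0.
have w1 i : w i <= 1.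
  apply: (@le_trans _ _ ((p i)%:R `^ 0)); last by rewrite powRr0.
  by apply: ler_powR; rewrite ?ler1n ?prime_gt0//; lra.
have NR : 0 < (N%:R : R) by rewrite ltr0n.
have Z0 : 0 < Z.
  by apply: prodr_gt0 => i _; have := sqr_ge0 (f i); lra.
have Q0 : 0 < Q.
  by apply: prodr_gt0 => i _; rewrite !addr_gt0 ?mulr_gt0 ?addr_gt0 ?mulr_gt0 ?exprn_gt0.
pose E := {ffun T -> 'I_3}.
pose x (e : E) := \prod_i level_weight (f i) (e i).
pose G : E -> E -> R := level_kernel w.
have x0 e : 0 < x e by apply: prodr_gt0 => i _; exact: level_weight_gt0.
have G0 e e' : 0 <= G e e' by apply: prodr_ge0 => i _; rewrite exprn_ge0 ?ltW.
have Gsym e e' : G e e' = G e' e.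
  by apply: eq_bigr => i _; rewrite /dist3 addnC.
have sumx : \sum_e x e ^+ 2 = Z.
  under eq_bigr => e _ do rewrite -prodrXl.
  rewrite -(bigA_distr_bigA (fun i a => level_weight (f i) a ^+ 2)).
  by apply: eq_bigr => i _; rewrite sum_level_sqr.
have sumQ : \sum_e \sum_e' x e * x e' * G e e' = Q.
  under eq_bigr => e _ do under eq_bigr => e' _ do rewrite -!big_split/=.
  rewrite (ffun_pair_sum (fun i a b =>
    level_weight (f i) a * level_weight (f i) b * w i ^+ dist3 a b)).
  by apply: eq_bigr => i _; rewrite sum_level_pair.
pose M (e : E) := Z <= x e ^+ 2 * N%:R.
(* Outside [M] the factor [(Z / (N x^2))^s] is at least 1. Once it is inserted, the sum may be
   extended to all [e] and becomes a product over the primes. *)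
have tailE : \sum_(e | ~~ M e) \sum_e' x e * x e' * G e e' <= Q / 4.
  rewrite ler_pdivlMr// mulrC; apply: le_trans tail; rewrite ler_pM2l//.
  apply: (@le_trans _ _ ((Z / N%:R) `^ s *
      \sum_e \sum_e' x e `^ (1 - 2 * s) * x e' * G e e')).
    rewrite mulr_sumr [leRHS](bigID M)/= -[leLHS]add0r; apply: lerD.
      apply: sumr_ge0 => e _; rewrite mulr_ge0 ?powR_ge0//; apply: sumr_ge0 => e' _.
      by rewrite !mulr_ge0 ?powR_ge0// ltW.
    apply: ler_sum => e; rewrite /M -ltNge => eM.
    rewrite mulr_sumr; apply: ler_sum => e' _.
    rewrite !mulrA ler_wpM2r// ler_wpM2r ?(ltW (x0 _))//.
    rewrite powRD; last by rewrite (gt_eqF (x0 _)) implybT.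
    rewrite powRr1 ?(ltW (x0 _))// mulrCA ler_peMr ?(ltW (x0 _))//.
    have -> : x e `^ (- (2 * s)) = (x e ^- 2) `^ s.
      by rewrite -mulNr powRrM powR_invn// ltW.
    have x2 : 0 < x e ^+ 2 by rewrite exprn_gt0.
    have y1 : 1 <= Z / N%:R * x e ^- 2.
      by rewrite ler_pdivlMr// mul1r ler_pdivlMr// ltW.
    rewrite -powRM ?invr_ge0 ?divr_ge0 ?(ltW Z0) ?(ltW NR) ?(ltW x2)//.
    have one1 : (1 : R) `^ s = 1 by rewrite powR1.
    rewrite -[leLHS]one1 ge0_ler_powR ?nnegrE// (le_trans _ y1)//.
  rewrite ler_wpM2l ?powR_ge0//.
  have xr e : x e `^ (1 - 2 * s) =
      \prod_i level_weight (f i `^ (1 - 2 * s)) (e i).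
    rewrite powR_prod => [|i]; last by rewrite ltW ?level_weight_gt0.
    apply: eq_bigr => i _; rewrite /level_weight; case: ifP => // _.
    by rewrite powR1.
  under [leLHS]eq_bigr => e _ do under eq_bigr => e' _ do rewrite xr -!big_split/=.
  rewrite (ffun_pair_sum (fun i a b => level_weight (f i `^ (1 - 2 * s)) a *
    level_weight (f i) b * w i ^+ dist3 a b)).
  by rewrite le_eqVlt; apply/orP; left; apply/eqP; apply: eq_bigr => i _; rewrite sum_level_pair.
set QM := \sum_(e | M e) \sum_(e' | M e') x e * x e' * G e e'.
have xG0 e e' : 0 <= x e * x e' * G e e' by rewrite !mulr_ge0 ?(ltW (x0 _)).
(* A pair that is not in [M x M] has its first or its second entry outside [M]; by symmetry each of
   the two tails is at most [Q / 4]. *)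
have QM2 : Q / 2 <= QM.
  have splitQ : Q <= QM + \sum_(e | ~~ M e) \sum_e' x e * x e' * G e e' +
      \sum_(e' | ~~ M e') \sum_e x e' * x e * G e' e.
    rewrite -sumQ (bigID M)/= [leRHS]addrAC; apply: lerD => //.
    under eq_bigr => e _ do rewrite (bigID M)/=.
    rewrite big_split/= lerD2l exchange_big/=; apply: ler_sum => e' _.
    rewrite [leRHS](bigID M)/= -[leLHS]addr0; apply: lerD; last exact: sumr_ge0.
    by apply: ler_sum => e _; rewrite Gsym mulrAC -mulrA mulrCA mulrC [x e' * _]mulrC.
  lra.
have lnN0 : 0 <= ln (N%:R : R) by rewrite ln_ge0// ler1n.
have [||||A [A0 AN SA]] := @layer_set R E E G
    (fun k => \prod_i tri_diag (w i) (k i))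
    (fun k e => \prod_i tri_coef (w i) (k i) (e i)) x Z (ln N%:R) M
    x0 Z0 _ lnN0 _ G0 (level_kernel_factor w) _ (lt_le_trans _ QM2).
- by rewrite sumx.
- move=> k; apply: prodr_ge0 => i _; rewrite /tri_diag; case: ifP => // _.
  by rewrite subr_ge0 expr_le1// ltW.
- by move=> e; rewrite /M lnK ?posrE.
- by move=> *; rewrite divr_gt0.
rewrite lnK in AN; last by rewrite posrE.
rewrite -/QM in SA.
pose B := [fset level_num p e | e in A]%fset.
have inj : {in A &, injective (level_num p)}.
  by move=> e e' _ _; exact: level_num_inj.
have SB : gal_sum sigma B = \sum_(e in A) \sum_(e' in A) G e e'.
  rewrite /gal_sum big_imfset//= big_enum/=; apply: eq_bigr => e _.
  rewrite big_imfset//= big_enum/=; apply: eq_bigr => e' _.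
  exact: level_num_ratio.
have BP : pos_sets #|A| B.
  split; first by rewrite card_in_imfset//= cardE.
  move=> m /imfsetP[e _ ->]; apply: prodn_gt0 => i.
  by rewrite expn_gt0 prime_gt0.
rewrite ler_nat in AN.
have := Gal_ge sigma BP (introT andP (conj A0 AN)); apply: le_trans.
rewrite lee_fin SB ler_pdivlMr ?mulr_gt0 ?ltr0n//.
have AR : 0 < (#|A|%:R : R) by rewrite ltr0n.
apply: le_trans SA.
rewrite (_ : _ * (2 * _) = (Q / 2) / (expR 1 * (ln N%:R + 1) ^+ 2 * Z) * #|A|%:R).
  by rewrite ler_pM2r// ler_pM2r// invr_gt0 !mulr_gt0 ?expR_gt0//; lra.
by field; rewrite ?(gt_eqF Z0) ?(gt_eqF AR) ?gt_eqF ?expR_gt0//; lra.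
Qed.

(** * First-order form of the product bound *)

Lemma expR_le_linear (R : realType) (eta y : R) :
  eta <= 1 / 2 -> 0 <= y -> y <= eta -> expR y <= 1 + (1 + 2 * eta) * y.
Proof.
move=> eta2 y0 yeta.
have /(_ (- y)) := @expR_ge1Dx R; rewrite expRN => H.
have e0 := expR_gt0 y.
have H1 : (1 - y) * expR y <= 1 by rewrite -ler_pdivlMr// mul1r.
have y1 : 0 < 1 - y by lra.
rewrite -(ler_pM2l y1); apply: (le_trans H1).
have H2 : (1 + 2 * eta) * y <= 2 * eta by nra.
by nra.
Qed.

Lemma ln_ge1V (R : realType) (x : R) : 0 < x -> 1 - x^-1 <= ln x.
Proof.
move=> x0; have xV0 : 0 < x^-1 by rewrite invr_gt0.
have := @le_ln1Dx R (x^-1 - 1) (ltac:(lra)).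
by rewrite (_ : 1 + _ = x^-1); [rewrite lnV ?posrE//; lra|ring].
Qed.

Lemma prod_le_expR (R : realType) (T : finType) (u q t : T -> R) :
  (forall i, 0 <= u i) -> (forall i, u i <= q i * expR (t i)) ->
  \prod_i u i <= (\prod_i q i) * expR (\sum_i t i).
Proof.
move=> u0 uq; rewrite expR_sum -big_split/=.
by apply: ler_prod => i _; rewrite u0 uq.
Qed.

(** Here [f^(1 - 2s) = f e^(2sg)], and [2sg <= eta] allows linearizing the exponential. The excess
    of the tail product over [Q] is then [s] times the entropy sum, the norm contributes [s] times
    the sum of the [2 f^2], and [ln 4 / s] pays for the factor 4; division by [s] gives the cost
    hypothesis. *)
Lemma Gal_ge_exp (R : realType) (sigma : R) (T : finType) (p : T -> nat)
    (f g : T -> R) (s eta : R) (N : nat) :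
  injective p -> (forall i, prime (p i)) -> 0 < sigma -> (0 < N)%N ->
  0 < s -> 0 < eta <= 1 / 2 ->
  let w i := (p i)%:R `^ (- sigma) in
  (forall i, f i = expR (- g i)) -> (forall i, 0 <= g i) ->
  (forall i, 2 * s * g i <= eta) ->
  (forall i, 2 * f i ^+ 2 + 4 * (f i * w i) + 2 * (f i * w i) ^+ 2 <= eta) ->
  \sum_i 4 * (1 + 2 * eta) * g i * (f i * w i + f i ^+ 2 * (1 + w i ^+ 2)) +
    \sum_i 2 * f i ^+ 2 + ln 4 / s <= ln N%:R ->
  ((expR ((1 - eta) * (4 * \sum_i f i * w i)) /
    (4 * expR 1 * (ln (N%:R : R) + 1) ^+ 2))%:E <= Gal sigma N)%E.
Proof.
move=> pI pP sg0 N0 s0 /andP[eta0 eta2] w fg g0 sg small cost.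
have w0 i : 0 < w i by rewrite powR_gt0// ltr0n prime_gt0.
have f0 i : 0 < f i by rewrite fg expR_gt0.
have NR : 0 < (N%:R : R) by rewrite ltr0n.
pose z i := 1 + 2 * f i ^+ 2.
pose q i := 1 + 2 * f i * w i + 2 * f i * (w i + f i + f i * w i ^+ 2).
have fw0 i : 0 < f i * w i by rewrite mulr_gt0.
have f20 i : 0 < f i ^+ 2 by rewrite exprn_gt0.
have z1 i : 1 <= z i by rewrite /z; have := f20 i; lra.
have qE i : q i = z i + (4 * (f i * w i) + 2 * (f i * w i) ^+ 2).
  by rewrite /q /z; ring.
have q1 i : 1 <= q i.
  by rewrite qE; have := z1 i; have := fw0 i; have := sqr_ge0 (f i * w i); lra.
have Z0 : 0 < \prod_i z i by apply: prodr_gt0 => i _; exact: lt_le_trans (z1 i).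
apply: le_trans (@Gal_ge_product R sigma T p f s N pI pP f0 sg0 (ltW s0) N0 _).
  rewrite lee_fin -/w -/q -/z.
  rewrite [leRHS](_ : _ = (\prod_i q i) / (\prod_i z i) /
      (4 * expR 1 * (ln N%:R + 1) ^+ 2)); last by rewrite [in LHS]invfM mulrA mulrAC.
  apply: ler_wpM2r; first by rewrite invr_ge0 mulr_ge0 ?sqr_ge0// mulr_ge0 ?expR_ge0.
  rewrite ler_pdivlMr// mulrC.
  rewrite [_ * (4 * _)](_ : _ = \sum_i (1 - eta) * (4 * (f i * w i))); last first.
    by rewrite -!mulr_sumr.
  apply: (le_trans (y := \prod_i (z i * expR ((1 - eta) * (4 * (f i * w i)))))).
    by rewrite big_split/= -expR_sum.
  apply: ler_prod => i _; rewrite mulr_ge0 ?expR_ge0//=; last first.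
    exact: le_trans (z1 i).
  have qz0 : 0 < q i / z i.
    by rewrite divr_gt0//; [exact: lt_le_trans (q1 i)|exact: lt_le_trans (z1 i)].
  have zi0 : 0 < z i by exact: lt_le_trans (z1 i).
  have qi0 : 0 < q i by exact: lt_le_trans (q1 i).
  rewrite mulrC -ler_pdivlMr// -[leRHS](@lnK R) ?posrE// ler_expR.
  (* [ln (q / z) >= (q - z) / q], where [q - z >= 4 f w], and [small] gives [q <= 1 + eta], hence
     [(1 - eta) q <= 1]. *)
  apply: le_trans (ln_ge1V qz0).
  rewrite invf_div lerBrDr -lerBrDl ler_pdivrMr//.
  have := small i; have := fw0 i; rewrite qE /z.
  set a := f i * w i; have := f20 i; set b := f i ^+ 2 => b0 a0 H.
  have a2 := sqr_ge0 a.
  have Hq : (1 - eta) * (1 + 2 * b + (4 * a + 2 * a ^+ 2)) <= 1 by nra.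
  nra.
have fs i : f i `^ (1 - 2 * s) = f i * expR (2 * s * g i).
  by rewrite fg /powR gt_eqF ?expR_gt0// expRK -expRD; congr expR; ring.
have u0 i : 0 <= 1 + 2 * f i * w i +
    2 * f i `^ (1 - 2 * s) * (w i + f i + f i * w i ^+ 2).
  have wf : 0 < w i + f i + f i * w i ^+ 2.
    by rewrite addr_gt0 ?addr_gt0 ?mulr_gt0 ?exprn_gt0.
  by have := fw0 i; have := mulr_ge0 (powR_ge0 (f i) (1 - 2 * s)) (ltW wf); lra.
pose c i := s * (4 * (1 + 2 * eta) * g i * (f i * w i + f i ^+ 2 * (1 + w i ^+ 2))).
have bound : \prod_i (1 + 2 * f i * w i +
    2 * f i `^ (1 - 2 * s) * (w i + f i + f i * w i ^+ 2)) <=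
    (\prod_i q i) * expR (\sum_i c i).
  apply: prod_le_expR => // i; rewrite fs; set e := expR _.
  have e1 : e <= 1 + (1 + 2 * eta) * (2 * s * g i).
    apply: expR_le_linear; [exact: eta2| |exact: sg].
    by rewrite mulr_ge0 ?g0// mulr_ge0 ?(ltW s0).
  pose A := f i * w i + f i ^+ 2 * (1 + w i ^+ 2).
  have A0 : 0 <= A.
    by rewrite ltW// addr_gt0// mulr_gt0// addr_gt0// exprn_gt0.
  rewrite (_ : _ + _ = q i + 2 * A * (e - 1)); last by rewrite /q /A; ring.
  have cE : c i = 2 * A * ((1 + 2 * eta) * (2 * s * g i)) by rewrite /c /A; ring.
  have c0 : 0 <= c i.
    have : 0 <= s * g i by rewrite mulr_ge0// ltW.
    by rewrite cE => sgi0; rewrite mulr_ge0 ?mulr_ge0//; lra.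
  have Ae : 2 * A * (e - 1) <= c i by rewrite cE ler_wpM2l ?mulr_ge0//; lra.
  have := expR_ge1Dx (c i); have := q1 i; nra.
have Zle : \prod_i z i <= expR (\sum_i 2 * f i ^+ 2).
  rewrite expR_sum; apply: ler_prod => i _.
  by rewrite (le_trans _ (z1 i))//= /z expR_ge1Dx.
have ZN : (\prod_i z i / N%:R) `^ s <= expR (s * (\sum_i 2 * f i ^+ 2 - ln N%:R)).
  rewrite [s * _]mulrC expRM ge0_ler_powR ?nnegrE ?expR_ge0 ?(ltW s0)//.
    by rewrite divr_ge0// ltW.
  by rewrite expRB lnK ?posrE// ler_pM2r// invr_gt0.
rewrite -/w -/q -/z.
apply: (@le_trans _ _ (4 * (expR (s * (\sum_i 2 * f i ^+ 2 - ln N%:R)) *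
   ((\prod_i q i) * expR (\sum_i c i))))).
  rewrite ler_pM2l// ler_pM ?powR_ge0//.
  exact: prodr_ge0.
have -> : 4 = expR (ln 4) :> R by rewrite lnK// posrE.
rewrite [leLHS](_ : _ = (\prod_i q i) * (expR (ln 4) *
   expR (s * (\sum_i 2 * f i ^+ 2 - ln N%:R)) * expR (\sum_i c i))); last by ring.
rewrite -!expRD ger_pMr; last by apply: prodr_gt0 => i _; exact: lt_le_trans (q1 i).
rewrite -[leRHS](@expR0 R) ler_expR /c -[X in _ + X]mulr_sumr.
move: cost; set S1 := \sum_i _; set S2 := \sum_i _ => cost.
have := ler_wpM2l (ltW s0) cost.
rewrite !mulrDr [s * (ln 4 / s)]mulrCA divff ?gt_eqF//; lra.
Qed.

(** * Mertens' first theorem *)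

Lemma prime_dvd_fact (p n : nat) : prime p -> (p %| n`!)%N = (p <= n)%N.
Proof.
move=> pp; elim: n => [|n IH].
  by rewrite fact0 Euclid_dvd1//; case: p pp.
by rewrite factS Euclid_dvdM// IH [RHS]leq_eqVlt ltnS; apply/orP/orP => -[H|H];
  [move: (dvdn_leq (ltn0Sn n) H); rewrite leq_eqVlt ltnS => /orP|right
  |left; rewrite (eqP H)|right].
Qed.

Lemma prod_primes_dvd (s : seq nat) (k : nat) :
  uniq s -> all prime s -> all (dvdn^~ k) s -> (\prod_(p <- s) p %| k)%N.
Proof.
elim: s => [|p s IH] /=; first by rewrite big_nil dvd1n.
move=> /andP[ps us] /andP[pp sp] /andP[pk sk].
rewrite big_cons Gauss_dvd ?pk ?IH//.
rewrite big_seq; apply: (big_ind (coprime p)); first exact: coprimen1.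
  by move=> x y cx cy; rewrite coprimeMr cx.
move=> q qs; rewrite prime_coprime// dvdn_prime2//; last exact: (allP sp).
by apply: contraNneq ps => ->.
Qed.

(** The ratio of consecutive terms is [2 (2m + 3) / (m + 2)], which is below 4. *)
Lemma bin_middle_le (m : nat) : ('C(m.*2.+1, m) <= 4 ^ m)%N.
Proof.
elim: m => [|m IH]; first by rewrite bin0.
have e1 : ('C(m.*2.+3, m.+1) * (m.+1 * m.+2) = 'C(m.*2.+1, m) * (m.*2.+2 * m.*2.+3))%N.
  have := mul_bin_diag m.*2.+3 m; have := mul_bin_down m.*2.+2 m.
  have -> : (m.*2.+2 - m = m.+2)%N by lia.
  rewrite /= => H1 H2.
  rewrite mulnA [('C(_, m.+1) * _)%N]mulnC -H2 -mulnA [('C(_, m) * m.+2)%N]mulnC -H1.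
  by rewrite mulnCA mulnA [RHS]mulnA [(_ * 'C(_, m))%N]mulnC !mulnA mulnAC.
rewrite doubleS expnS -(@leq_pmul2r (m.+1 * m.+2)) ?muln_gt0// e1.
apply: (@leq_trans (4 ^ m * (m.*2.+2 * m.*2.+3))); first by rewrite leq_mul2r IH orbT.
rewrite [(4 * 4 ^ m)%N]mulnC -mulnA leq_mul2l; apply/orP; right; nia.
Qed.

(** Erdos's argument: the primes in [(m + 1, 2m + 1]] all divide the binomial coefficient
    [C(2m + 1, m)], and an even bound above 2 is not prime. *)
Lemma primorial_le (n : nat) :
  (\prod_(0 <= p < n.+1 | prime p) p <= 4 ^ n)%N.
Proof.
have [k] := ubnP n; elim: k n => // k IH n; rewrite ltnS => nk.
case: n nk => [|[|[|n]]] nk; [by rewrite unlock| by rewrite unlock|by rewrite unlock|].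
(* The bound is now [n.+3], so its parity is opposite to that of [n]. *)
have [n1 | n0] := boolP (odd n); last first.
  have [m nE] : exists m, n = m.*2 by exists n./2; rewrite even_halfK.
  have split_prod : (\prod_(0 <= p < n.+4 | prime p) p =
    (\prod_(0 <= p < m.+3 | prime p) p) * \prod_(m.+3 <= p < n.+4 | prime p) p)%N.
    by rewrite (@big_cat_nat _ _ _ m.+3)//; lia.
  rewrite split_prod; apply: (@leq_trans (4 ^ m.+2 * 'C(m.+1.*2.+1, m.+1))).
    apply: leq_mul; first by apply: IH; lia.
    apply: dvdn_leq; first by rewrite bin_gt0; lia.
    rewrite -big_filter; apply: prod_primes_dvd.
    - by rewrite filter_uniq// iota_uniq.
    - by apply/allP => p; rewrite mem_filter => /andP[].
    - apply/allP => p; rewrite mem_filter mem_index_iota => /andP[pp /andP[mp pn]].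
      have : (p %| m.+1.*2.+1`!)%N by rewrite prime_dvd_fact//; lia.
      rewrite -(@bin_fact m.+1.*2.+1 m.+1); last by lia.
      rewrite (_ : m.+1.*2.+1 - m.+1 = m.+2)%N; last by lia.
      rewrite Euclid_dvdM// => /orP[//|]; rewrite Euclid_dvdM// => /orP[];
        by rewrite prime_dvd_fact//; lia.
  have -> : n.+3 = (m.+2 + m.+1)%N by lia.
  by rewrite expnD leq_mul2l bin_middle_le orbT.
rewrite big_mkcond big_nat_recr//= -big_mkcond/= ifN ?muln1; last first.
  apply/negP => /even_prime [//|]; rewrite /= n1; lia.
apply: (@leq_trans (4 ^ n.+2)); first by apply: IH; lia.
by rewrite leq_exp2l.
Qed.

Lemma theta_le (R : realType) (n : nat) :
  \sum_(0 <= p < n.+1 | prime p) ln (p%:R : R) <= n%:R * ln 4.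
Proof.
have -> : \sum_(0 <= p < n.+1 | prime p) ln (p%:R : R) =
    ln (\prod_(0 <= p < n.+1 | prime p) p)%N%:R.
  apply: (big_ind2 (fun (a : R) (b : nat) => (0 < b)%N /\ a = ln b%:R) _ _ _).2.
  - by rewrite ln1.
  - move=> x1 x2 y1 y2 [x0 ->] [y0 ->]; split; first by rewrite muln_gt0 x0.
    by rewrite natrM lnM// posrE ltr0n.
  - by move=> p pp; rewrite prime_gt0.
rewrite mulr_natl -lnXn// ler_ln ?posrE ?exprn_gt0//.
  by rewrite -natrX ler_nat primorial_le.
by rewrite ltr0n prodn_cond_gt0// => p; exact: prime_gt0.
Qed.

Lemma ln_fact_decomp (R : realType) (n : nat) :
  ln (n`!%:R : R) =
  \sum_(0 <= p < n.+1 | prime p) (logn p n`!)%:R * ln (p%:R : R).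
Proof.
have ln_decomp (s : seq nat) (e : nat -> nat) : all prime s ->
    ln ((\prod_(p <- s) p ^ e p)%N%:R : R) = \sum_(p <- s) (e p)%:R * ln (p%:R : R).
  elim: s => [|p s IH] /=; first by rewrite !big_nil ln1.
  move=> /andP[pp sp]; rewrite !big_cons natrM lnM ?IH//.
  - by rewrite natrX lnXn ?ltr0n ?prime_gt0// mulr_natl.
  - by rewrite posrE ltr0n expn_gt0 prime_gt0.
  - rewrite posrE ltr0n big_seq prodn_cond_gt0// => q /(allP sp) qp.
    by rewrite expn_gt0 prime_gt0.
rewrite {1}(prod_prime_decomp (fact_gt0 n)) prime_decompE big_map/= ln_decomp.
  rewrite -[RHS]big_filter; apply/perm_big/uniq_perm.
  - exact: primes_uniq.
  - by rewrite filter_uniq// iota_uniq.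
  - move=> p; rewrite mem_primes mem_filter mem_index_iota fact_gt0/= ltnS.
    by case: (boolP (prime p)) => //= pp; rewrite prime_dvd_fact.
by apply/allP => p; rewrite mem_primes => /andP[].
Qed.

Lemma ln_fact_le (R : realType) (n : nat) : ln (n`!%:R : R) <= n%:R * ln n%:R.
Proof.
case: n => [|n]; first by rewrite fact0 ln1 mul0r.
rewrite mulr_natl -lnXn ?ltr0n// ler_ln ?posrE ?exprn_gt0 ?ltr0n ?fact_gt0//.
rewrite -natrX ler_nat; elim: (n.+1) => // -[//|k] IH; rewrite factS expnS.
by rewrite leq_mul2l/= (leq_trans IH)// leq_exp2r.
Qed.

(** [n^n / n!] is a single term of the series of [e^n]. *)
Lemma ln_fact_ge (R : realType) (n : nat) :
  n%:R * ln n%:R - n%:R <= ln (n`!%:R : R).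
Proof.
case: n => [|n]; first by rewrite fact0 ln1 mul0r subr0.
have n0 : 0 < (n.+1%:R : R) by rewrite ltr0n.
have f0 : 0 < (n.+1`!%:R : R) by rewrite ltr0n fact_gt0.
have := @expR_ge1Dxn R _ n (ltW n0); rewrite addrC => /(le_trans _) H.
have {H} : (n.+1%:R : R) ^+ n.+1 / n.+1`!%:R <= expR n.+1%:R.
  by apply: H; rewrite lerDl.
rewrite -ler_ln ?posrE ?expR_gt0 ?divr_gt0 ?exprn_gt0//.
rewrite expRK ln_div ?posrE ?exprn_gt0// lnXn// mulr_natl; lra.
Qed.

Lemma sum_lnV_le (R : realType) (n : nat) :
  \sum_(0 <= k < n.+1 | prime k) ln (k%:R : R) / (k%:R * (k%:R - 1)) <= 3.
Proof.
(* The subtracted quantity dominates the remaining tail: from [m] to [m + 1] it decreases by at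
   least the new term, prime or not. *)
suff H m : \sum_(0 <= k < m.+2 | prime k) ln (k%:R : R) / (k%:R * (k%:R - 1)) <=
    3 - (ln (m.+2%:R) + 1) / m.+1%:R.
  case: n => [|n]; first by rewrite unlock.
  apply: le_trans (H n) _; rewrite lerBlDr lerDl divr_ge0//.
  by rewrite addr_ge0// ln_ge0// ler1n.
elim: m => [|{}n IH].
  rewrite unlock/= divr1; have := @le_ln1Dx R 1; rewrite (_ : 1 + 1 = 2 :> R) //.
  by move=> /(_ _) H; have := H ltac:(lra); lra.
rewrite big_mkcond big_nat_recr//= -big_mkcond/=.
set a := if _ then _ else _.
have x0 : 0 < (n.+1%:R : R) by rewrite ltr0n.
have lnn0 : 0 <= ln (n.+2%:R : R) by rewrite ln_ge0// ler1n.
have -> : (n.+3%:R : R) = n.+2%:R * (1 + n.+2%:R^-1).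
  by rewrite mulrDr mulr1 divff ?natr1// pnatr_eq0.
have y0 : 0 < (n.+2%:R : R)^-1 by rewrite invr_gt0 ltr0n.
rewrite lnM ?posrE ?ltr0n ?addr_gt0//.
have lny : ln (1 + n.+2%:R^-1) <= (n.+2%:R : R)^-1 by apply: le_ln1Dx; rewrite (lt_trans _ y0)// ltrN10.
have aE : a <= ln (n.+2%:R : R) / (n.+2%:R * n.+1%:R).
  rewrite /a; case: ifP => _.
    by rewrite (_ : n.+2%:R - 1 = n.+1%:R :> R)// -[n.+2%:R]natr1 addrK.
  by rewrite divr_ge0// mulr_ge0.
apply: le_trans (lerD IH aE) _.
move: lny y0 lnn0; rewrite -[n.+2%:R]natr1; move: (n.+1%:R) x0 => x x0.
set l := ln (x + 1); set m := ln (1 + _) => lny y0 lnn0.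
have -> : 3 - (l + 1) / x + l / ((x + 1) * x) = 3 - (l + (1 + x^-1)) / (x + 1).
  by field; lra.
rewrite lerD2l lerN2 ler_pM2r//.
have : (x + 1)^-1 <= x^-1 by rewrite lef_pV2 ?posrE; lra.
lra.
Qed.

(** [n / p < floor (n / p) + 1], and the floor is at most the exponent of [p] in [n!]; multiplied by
    [ln p] and summed, this bounds [n] times the left side by [ln n!] plus the Chebyshev
    function. *)
Lemma mertens_upper (R : realType) (n : nat) : (0 < n)%N ->
  \sum_(0 <= p < n.+1 | prime p) ln (p%:R : R) / p%:R <= ln n%:R + ln 4.
Proof.
move=> n0; have nR : 0 < (n%:R : R) by rewrite ltr0n.
rewrite -(ler_pM2l nR) mulrDr.
apply: le_trans (lerD (ln_fact_le R n) (theta_le R n)).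
rewrite ln_fact_decomp -big_split/= mulr_sumr; apply: ler_sum => p pp.
have p0 := prime_gt0 pp; have pR : 0 < (p%:R : R) by rewrite ltr0n.
have lp : 0 <= ln (p%:R : R) by rewrite ln_ge0// ler1n.
rewrite -[X in _ + X]mul1r -mulrDl mulrCA mulrC ler_wpM2r// ler_pdivrMr//.
rewrite natr1 -natrM ler_nat ltnW// (leq_trans (ltn_ceil n p0))// leq_mul2r ltnS.
by rewrite logn_fact// big_ltn// expn1 leq_addr orbT.
Qed.

Lemma logn_fact_le (R : realType) (p n : nat) : prime p ->
  (logn p n`!)%:R <= n%:R / (p%:R - 1) :> R.
Proof.
move=> pp; have p1 : 1 < (p%:R : R) by rewrite ltr1n prime_gt1.
have pR : 0 < (p%:R : R) by lra.
rewrite logn_fact// natr_sum.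
suff geom m : \sum_(1 <= k < m.+1) ((n %/ p ^ k)%:R : R) <=
    n%:R / (p%:R - 1) * (1 - p%:R ^- m).
  apply: le_trans (geom n) _; apply: ler_piMr; first by rewrite divr_ge0//; lra.
  by rewrite lerBlDr lerDl invr_ge0 exprn_ge0// ltW.
elim: m => [|m IH]; first by rewrite big_geq// expr0 invr1 subrr mulr0.
rewrite big_nat_recr//=.
have H : ((n %/ p ^ m.+1)%:R : R) <= n%:R * p%:R ^- m.+1.
  rewrite ler_pdivlMr ?exprn_gt0// -natrX -natrM ler_nat; exact: leq_trunc_div.
apply: le_trans (lerD IH H) _; rewrite le_eqVlt; apply/orP; left; apply/eqP.
rewrite exprS invfM; have : p%:R ^- m != 0 :> R by rewrite invr_eq0 gt_eqF// exprn_gt0.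
by move: (p%:R ^- m) => q q0; field; lra.
Qed.

(** Legendre's formula bounds the exponent of [p] in [n!] by [n / (p - 1)]. Replacing [1 / (p - 1)]
    by [1 / p] costs at most 3, and the lower bound for [ln n!] costs 1. *)
Lemma mertens_lower (R : realType) (n : nat) : (0 < n)%N ->
  ln n%:R - 4 <= \sum_(0 <= p < n.+1 | prime p) ln (p%:R : R) / p%:R.
Proof.
move=> n0; have nR : 0 < (n%:R : R) by rewrite ltr0n.
have : ln (n`!%:R : R) <= n%:R * (\sum_(0 <= p < n.+1 | prime p) ln (p%:R : R) / p%:R
   + \sum_(0 <= p < n.+1 | prime p) ln (p%:R : R) / (p%:R * (p%:R - 1))).
  rewrite ln_fact_decomp -big_split/= mulr_sumr; apply: ler_sum => p pp.
  have p1 : 1 < (p%:R : R) by rewrite ltr1n prime_gt1.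
  have lp : 0 <= ln (p%:R : R) by rewrite ln_ge0// ltW.
  rewrite (_ : _ + _ = ln p%:R / (p%:R - 1)); last by field; lra.
  rewrite [leRHS](_ : _ = (n%:R / (p%:R - 1)) * ln p%:R); last by ring.
  by rewrite ler_wpM2r// logn_fact_le.
have := ln_fact_ge R n; have := sum_lnV_le R n.
set A := \sum_(_ <= _ < _ | _) _; set B := \sum_(_ <= _ < _ | _) _ => H1 H2 H3.
rewrite -(ler_pM2l nR).
have : n%:R * A <= n%:R * 3 by rewrite ler_pM2l.
move: H2 H3; rewrite mulrDr mulrBr; lra.
Qed.

(** * Distribution of the mass over the primes *)

Lemma ln2_le1 (R : realType) : ln (2 : R) <= 1.
Proof.
have := @le_ln1Dx R 1; rewrite (_ : 1 + 1 = 2 :> R) //.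
by move=> H; apply: H; lra.
Qed.

Lemma ln_truncn (R : realType) (x : R) : 1 <= x ->
  [/\ (0 < Num.truncn x)%N, ln x - 1 <= ln (Num.truncn x)%:R
    & ln (Num.truncn x)%:R <= ln x].
Proof.
move=> x1; have n0 : (0 < Num.truncn x)%N by rewrite truncn_gt0.
have x0 : 0 < x by lra.
have /andP[nx xn] := truncn_itv (ltW x0).
have nR : 0 < ((Num.truncn x)%:R : R) by rewrite ltr0n.
have n1 : 1 <= ((Num.truncn x)%:R : R) by rewrite ler1n.
split=> //; last by rewrite ler_ln ?posrE.
rewrite lerBlDr; apply: (@le_trans _ _ (ln ((Num.truncn x)%:R * 2))).
  by rewrite ler_ln ?posrE ?mulr_gt0//; move: xn; rewrite -natr1; lra.
by rewrite lnM ?posrE// lerD2l ln2_le1.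
Qed.

(** The 7 is 4 from the lower bound, [ln 4 <= 2] from the upper bound, and 1 from truncation. *)
Lemma mertens_itv (R : realType) (x y : R) : 1 <= x -> x <= y ->
  `| \sum_((Num.truncn x).+1 <= p < (Num.truncn y).+1 | prime p)
       ln (p%:R : R) / p%:R - (ln y - ln x)| <= 7.
Proof.
move=> x1 xy; have y1 : 1 <= y by exact: le_trans xy.
have [nx0 lx1 lx2] := ln_truncn x1; have [ny0 ly1 ly2] := ln_truncn y1.
have nxy : (Num.truncn x <= Num.truncn y)%N by exact: le_truncn.
have l4 : ln (4 : R) <= 2.
  rewrite (_ : 4 = 2 * 2 :> R); last by ring.
  by rewrite lnM ?posrE//; have := @ln2_le1 R; lra.
have := mertens_upper R ny0; have := mertens_lower R ny0.
have := mertens_upper R nx0; have := mertens_lower R nx0.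
rewrite [\sum_(0 <= p < (Num.truncn y).+1 | _) _](@big_cat_nat _ _ _ (Num.truncn x).+1)//=.
set A := \sum_(0 <= _ < _ | _) _; set B := \sum_(_ <= _ < _ | _) _.
by rewrite ler_norml => *; apply/andP; split; lra.
Qed.

Definition block_end (R : realType) (L t : R) : nat := Num.truncn (L * expR t).

Lemma block_endP (R : realType) (L t t' : R) (p : nat) : 0 < L ->
  (block_end L t < p < (block_end L t').+1)%N ->
  t < ln p%:R - ln L <= t'.
Proof.
move=> L0 /andP[tp pt']; have e0 s : 0 < L * expR s by rewrite mulr_gt0 ?expR_gt0.
have p0 : 0 < (p%:R : R) by rewrite ltr0n; apply: leq_ltn_trans tp.
have lnLe s : ln L + s = ln (L * expR s) by rewrite lnM ?posrE ?expR_gt0// expRK.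
rewrite ltrBrDl lerBlDl !lnLe ltr_ln ?ler_ln ?posrE//; apply/andP; split.
  by rewrite (lt_le_trans (truncnS_gt _))// ler_nat.
rewrite ltnS in pt'; apply: (@le_trans _ _ (block_end L t')%:R); first by rewrite ler_nat.
by have /andP[] := truncn_itv (ltW (e0 t')).
Qed.

(* [u = ln p - ln L] is the position of the prime [p] on the scale [p = L e^u]. *)
Definition prime_mass (R : realType) (a L : R) (p : nat) : R :=
  p%:R `^ (- (1 + 2 * a)) / (ln p%:R - ln L).

(** The mass is [L^(-2a) e^(-2au) / (u (ln L + u))] times the Mertens weight [ln p / p]. The first
    factor is decreasing in [u], so the ends of the block bound it. *)
Lemma block_sum (R : realType) (a L t t' : R) : 0 <= a -> 1 < L -> 0 < t -> t <= t' ->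
  let S := \sum_((block_end L t).+1 <= p < (block_end L t').+1 | prime p)
    prime_mass a L p in
  S <= L `^ (- (2 * a)) / (t * ln L) * (t' - t + 7) /\
  L `^ (- (2 * a)) * expR (- (2 * a * t')) / (t' * (ln L + t')) * (t' - t - 7) <= S.
Proof.
move=> a0 L1 t0 tt' S; have L0 : 0 < L by lra.
have lnL : 0 < ln L by rewrite ln_gt0.
have t'0 : 0 < t' by lra.
have e1 : 1 <= L * expR t.
  have := expR_ge1Dx t; nra.
have e12 : L * expR t <= L * expR t' by rewrite ler_pM2l// ler_expR.
have := mertens_itv e1 e12; rewrite !lnM ?posrE ?expR_gt0// !expRK.
rewrite -/(block_end L t) -/(block_end L t').
set M := \sum_(_ <= _ < _ | _) _; rewrite ler_norml => /andP[M1 M2].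
have L2 : 0 < L `^ (- (2 * a)) by rewrite powR_gt0.
have massE p : (block_end L t < p < (block_end L t').+1)%N ->
    prime_mass a L p = L `^ (- (2 * a)) * (expR (- (2 * a * (ln p%:R - ln L))) /
      ((ln p%:R - ln L) * ln p%:R)) * (ln p%:R / p%:R).
  move=> pb; have /andP[tu ut'] := block_endP L0 pb.
  have p0 : 0 < (p%:R : R).
    by rewrite ltr0n; case/andP: pb => /(leq_ltn_trans (leq0n _)).
  have -> : expR (- (2 * a * (ln p%:R - ln L))) = p%:R `^ (- (2 * a)) / L `^ (- (2 * a)).
    rewrite /powR !gt_eqF// -expRB; congr expR; ring.
  rewrite /prime_mass opprD powRD; last by rewrite (gt_eqF p0) implybT.
  rewrite powR_inv1 ?(ltW p0)//.
  by field; rewrite !gt_eqF//=; lra.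
have pick_sum (F : nat -> R) : \sum_((block_end L t).+1 <= p < (block_end L t').+1 | prime p) F p
   = \sum_(p <- [seq p <- index_iota (block_end L t).+1 (block_end L t').+1 | prime p]) F p.
  by rewrite big_filter.
have inb p : p \in [seq p <- index_iota (block_end L t).+1 (block_end L t').+1 | prime p] ->
    (block_end L t < p < (block_end L t').+1)%N.
  by rewrite mem_filter mem_index_iota => /andP[].
split.
- apply: (@le_trans _ _ (L `^ (- (2 * a)) / (t * ln L) * M)); last first.
    by rewrite ler_wpM2l ?divr_ge0 ?mulr_ge0 ?(ltW L2) ?(ltW t0) ?(ltW lnL)//; lra.
  rewrite /S /M !pick_sum mulr_sumr big_seq [leRHS]big_seq; apply: ler_sum => p /inb pb.
  have /andP[tu ut'] := block_endP L0 pb.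
  have lp : 0 < ln (p%:R : R) by lra.
  rewrite massE// ler_wpM2r ?divr_ge0 ?(ltW lp)//.
  rewrite ler_pM2l// -[leRHS]mul1r ler_pM ?expR_ge0//.
  + by rewrite invr_ge0 mulr_ge0; lra.
  + rewrite -[leRHS](@expR0 R) ler_expR oppr_le0 !mulr_ge0//; lra.
  + by rewrite lef_pV2 ?posrE ?mulr_gt0 ?ler_pM//; lra.
- have q0 : 0 < t' * (ln L + t') by rewrite mulr_gt0//; lra.
  apply: (@le_trans _ _ (L `^ (- (2 * a)) * expR (- (2 * a * t')) / (t' * (ln L + t')) * M)).
    by rewrite ler_wpM2l ?divr_ge0 ?mulr_ge0 ?(ltW L2) ?expR_ge0//; lra.
  rewrite /S /M !pick_sum mulr_sumr big_seq [leRHS]big_seq; apply: ler_sum => p /inb pb.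
  have /andP[tu ut'] := block_endP L0 pb.
  have lp : 0 < ln (p%:R : R) by lra.
  rewrite massE// ler_wpM2r ?divr_ge0 ?(ltW lp)//.
  rewrite -mulrA ler_pM2l// ler_pM ?expR_ge0 ?invr_ge0 ?(ltW q0)//.
  + by rewrite ler_expR lerN2 ler_wpM2l// mulr_ge0.
  + by rewrite lef_pV2 ?posrE ?mulr_gt0 ?ler_pM//; lra.
Qed.

(** On geometric blocks the density [1 / u] gives every block the same mass up to constants, so the
    total is proportional to [K]. The Mertens error 7 is absorbed because each block starts at
    [t >= u >= 7]: [(t lam - t + 7) / t <= lam]. *)
Lemma mass_sum (R : realType) (a L u lam : R) (K : nat) :
  0 <= a -> 1 < L -> 7 <= u -> 1 < lam ->
  let S := \sum_((block_end L u).+1 <= p < (block_end L (u * lam ^+ K)).+1 | prime p)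
    prime_mass a L p in
  S <= K%:R * (L `^ (- (2 * a)) / ln L * lam) /\
  (7 / u <= 1 - lam^-1 ->
  K%:R * (L `^ (- (2 * a)) * expR (- (2 * a * (u * lam ^+ K))) /
    (ln L + u * lam ^+ K) * (1 - lam^-1 - 7 / u)) <= S).
Proof.
move=> a0 L1 u7 lam1; have L0 : 0 < L by lra.
have lnL : 0 < ln L by rewrite ln_gt0.
have u0 : 0 < u by lra.
have lam0 : 0 < lam by lra.
have L2 : 0 < L `^ (- (2 * a)) by rewrite powR_gt0.
pose t k := u * lam ^+ k.
have tu k : u <= t k by rewrite /t ler_peMr ?(ltW u0)// exprn_ege1// ltW.
have tS k : t k.+1 = t k * lam by rewrite /t exprSr mulrA.
have tm k : t k <= t k.+1 by rewrite tS ler_peMr ?(ltW lam1)//; have := tu k; lra.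
have tmono : {homo t : j k / (j <= k)%N >-> j <= k}.
  by apply: homo_leq => // x y z; exact: le_trans.
have bmono j k : (j <= k)%N -> (block_end L (t j) <= block_end L (t k))%N.
  by move=> /tmono jk; apply: le_truncn; rewrite ler_pM2l// ler_expR.
have split_sum k (F : nat -> R) :
    \sum_((block_end L (t 0)).+1 <= p < (block_end L (t k)).+1 | prime p) F p =
    \sum_(j < k) \sum_((block_end L (t j)).+1 <= p < (block_end L (t j.+1)).+1 | prime p) F p.
  elim: k => [|k IH]; first by rewrite big_ord0 big_geq.
  by rewrite big_ord_recr/= -IH (@big_cat_nat _ _ _ (block_end L (t k)).+1)//= ltnS bmono.
have t0 : t 0%N = u by rewrite /t expr0 mulr1.
have sumK (c : R) : K%:R * c = \sum_(j < K) c.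
  by rewrite sumr_const card_ord mulr_natl.
have := split_sum K (prime_mass a L); rewrite t0 {1}/t => -> S.
rewrite {}/S (_ : u * lam ^+ K = t K)//; have tuK := tu K; clearbody t; split.
- rewrite sumK; apply: ler_sum => j _.
  have tj := tu j; have [H _] := block_sum a0 L1 (lt_le_trans u0 tj) (tm j).
  apply: (le_trans H).
  rewrite [leLHS](_ : _ = L `^ (- (2 * a)) / ln L * ((t j.+1 - t j + 7) / t j)); last first.
    by field; rewrite !gt_eqF//; lra.
  rewrite ler_pM2l ?divr_gt0// ler_pdivrMr ?tS; lra.
- move=> lam7; rewrite sumK; apply: ler_sum => j _.
  have tj := tu j; have [_ H] := block_sum a0 L1 (lt_le_trans u0 tj) (tm j).
  apply: le_trans H.
  have tjK : t j.+1 <= t K by apply: tmono.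
  have tj1 := tu j.+1.
  rewrite [leRHS](_ : _ = L `^ (- (2 * a)) * expR (- (2 * a * t j.+1)) / (ln L + t j.+1) *
    ((t j.+1 - t j - 7) / t j.+1)); last by field; rewrite !gt_eqF//; lra.
  have -> : (t j.+1 - t j - 7) / t j.+1 = 1 - lam^-1 - 7 / t j.+1.
    by rewrite tS; field; rewrite !gt_eqF//; lra.
  have i7 : 7 / t j.+1 <= 7 / u by rewrite ler_pM2l// lef_pV2 ?posrE//; lra.
  apply: ler_pM.
  + by rewrite divr_ge0 ?mulr_ge0 ?expR_ge0 ?(ltW L2)//; lra.
  + lra.
  + apply: ler_pM; rewrite ?mulr_ge0 ?invr_ge0 ?expR_ge0 ?(ltW L2)//.
    * lra.
    * by rewrite ler_pM2l// ler_expR lerN2 ler_wpM2l ?mulr_ge0.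
    * by rewrite lef_pV2 ?posrE//; lra.
  + lra.
Qed.

(** * Growth estimates and the size of the mass *)

Lemma near_poly_le_expR (R : realType) (a C : R) (k : nat) : 0 < a ->
  \forall x \near +oo, C * x ^+ k <= expR (a * x).
Proof.
move=> a0; near=> x.
have x0 : 0 <= x by near: x; apply: nbhs_pinfty_ge.
have xC : C * (k.+1)`!%:R / a ^+ k.+1 <= x by near: x; apply: nbhs_pinfty_ge; rewrite num_real.
have ax : 0 <= a * x by rewrite mulr_ge0// ltW.
have := expR_ge1Dxn k ax; apply: le_trans.
have f0 : 0 < ((k.+1)`!%:R : R) by rewrite ltr0n fact_gt0.
have ak : 0 < a ^+ k.+1 by rewrite exprn_gt0.
rewrite -[leLHS]add0r lerD// exprMn ler_pdivlMr//.
rewrite ler_pdivrMr// in xC.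
rewrite [leLHS](_ : _ = x ^+ k * (C * (k.+1)`!%:R)); last by ring.
rewrite [leRHS](_ : _ = x ^+ k * (x * a ^+ k.+1)); last by rewrite !exprSr; ring.
by rewrite ler_wpM2l// exprn_ge0.
Unshelve. all: end_near. Qed.

Lemma near_ln_le (R : realType) (a C : R) : 0 < a ->
  \forall x \near +oo, C + ln x <= a * x.
Proof.
move=> a0; near=> x.
have x0 : 0 < x by near: x; apply: nbhs_pinfty_gt.
have : expR C * x ^+ 1 <= expR (a * x).
  by near: x; exact: near_poly_le_expR.
rewrite expr1 -ler_ln ?posrE ?mulr_gt0 ?expR_gt0//.
by rewrite expRK lnM ?posrE ?expR_gt0// expRK.
Unshelve. all: end_near. Qed.

(* "[x] is large in terms of [eta]": everything required below of both
   [l = - ln alpha] and [Y = loglog N]. *)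
Definition large (R : realType) (eta x : R) : Prop :=
  [/\ 8 <= x, 7 <= eta ^+ 2 * x, ln (1 + eta) + ln x <= eta * x,
      2 <= eta * expR (eta * x) & 8 <= eta * expR x] /\
  [/\ ln (4 / ((1 - 2 * eta) ^+ 4 * ln (1 + eta))) + ln x <= eta / 3 * x,
      ln x <= eta / 6 * x & 2 * x <= ln (1 + eta) * expR x] /\
  [/\ 16 / eta * x <= expR (1 / 2 * x), 4 / eta ^+ 2 * x <= expR x
    & 49 / eta ^+ 2 * x ^+ 3 <= expR (1 / 2 * x)].

Lemma near_large (R : realType) (eta : R) : 0 < eta ->
  \forall x \near +oo, large eta x.
Proof.
move=> e0; have l0 : 0 < ln (1 + eta) by rewrite ln_gt0//; lra.
have e20 : 0 < eta ^+ 2 by rewrite exprn_gt0.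
have nc (C a : R) : 0 < a -> \forall x \near +oo, C <= expR (a * x).
  move=> a0; near=> x; have : C * x ^+ 0 <= expR (a * x).
    by near: x; exact: near_poly_le_expR.
  by rewrite expr0 mulr1.
have nl (C a : R) : 0 < a -> \forall x \near +oo, C * x <= expR (a * x).
  move=> a0; near=> x; have : C * x ^+ 1 <= expR (a * x).
    by near: x; exact: near_poly_le_expR.
  by rewrite expr1.
near=> x; have mul1x : expR x = expR (1 * x) by rewrite mul1r.
split; [split|split; [split|split]].
- by near: x; apply: nbhs_pinfty_ge; rewrite num_real.
- by rewrite -ler_pdivrMl//; near: x; apply: nbhs_pinfty_ge; rewrite num_real.
- by near: x; exact: near_ln_le.
- by rewrite -ler_pdivrMl//; near: x; exact: nc.
- by rewrite -ler_pdivrMl// mul1x; near: x; exact: nc.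
- by near: x; apply: near_ln_le; lra.
- by rewrite -[leLHS]add0r; near: x; apply: near_ln_le; lra.
- by rewrite -ler_pdivrMl// mulrA mul1x; near: x; exact: nl.
- by near: x; apply: nl; lra.
- by rewrite mul1x; near: x; exact: nl.
- by near: x; apply: near_poly_le_expR; lra.
Unshelve. all: end_near. Qed.

Lemma mass_bounds (R : realType) (eta l Y : R) : 0 < eta <= 1 / 40 ->
  large eta l -> large eta Y -> expR l <= Y ->
  let a := expR (- l) in
  let L := expR Y * Y in
  let kap := 1 - 2 * eta in
  exists U, [/\ l <= U, U <= Y &
    let A := \sum_((block_end L l).+1 <= p < (block_end L U).+1 | prime p)
      prime_mass a L p in
    kap ^+ 4 * l * (L `^ (- (2 * a)) / Y) <= A /\
    A <= 2 * l / ln (1 + eta) * (L `^ (- (2 * a)) / Y)].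
Proof.
move=> /andP[e0 e40] [[l8 l7 l2 l3 l4] _] [[Y8 _ _ _ _] [[_ Y1 _] _]] lY a L kap.
have aE : a = expR (- l) by [].
have LE : L = expR Y * Y by [].
have kapE : kap = 1 - 2 * eta by [].
clearbody a L kap.
have lam1 : 1 < 1 + eta by lra.
have lnlam : 0 < ln (1 + eta) by rewrite ln_gt0.
have lnlame : ln (1 + eta) <= eta by apply: le_ln1Dx; lra.
have l0 : 0 < l by lra.
have Y0 : 0 < Y by lra.
have lnY0 : 0 <= ln Y by rewrite ln_ge0//; lra.
have eY0 := expR_gt0 Y.
have L1 : 1 < L by have := expR_ge1Dx Y; rewrite LE; nra.
have lnL : ln L = Y + ln Y by rewrite LE lnM ?posrE// expRK.
have a0 : 0 < a by rewrite aE expR_gt0.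
(* [r] solves [l (1 + eta)^r = e^((1 - eta) l)]. Its floor [K] puts [U] just below [a^(-(1 - eta))],
   so that [a U] is small and [U] is small against [Y], while [K ln (1 + eta)] is still close to
   [l]. *)
pose r := ((1 - eta) * l - ln l) / ln (1 + eta).
have r0 : 0 <= r by rewrite divr_ge0 ?(ltW lnlam)//; nra.
have [K /andP[Kr rK]] : exists K : nat, K%:R <= r < K%:R + 1.
  by exists (Num.truncn r); have := truncn_itv r0; rewrite -natr1.
have rE : r * ln (1 + eta) = (1 - eta) * l - ln l.
  by rewrite /r divfK// gt_eqF.
clearbody r.
have [U UdE] : exists U, U = l * (1 + eta) ^+ K by eexists.
have lU : l <= U by rewrite UdE ler_peMr ?(ltW l0)// exprn_ege1// ltW.
have UE : U <= expR ((1 - eta) * l).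
  have p0 : 0 < (1 + eta) ^+ K by rewrite exprn_gt0//; lra.
  have U0 : 0 < U by exact: lt_le_trans lU.
  have lnU : ln U = ln l + K%:R * ln (1 + eta).
    by rewrite UdE lnM ?posrE// lnXn ?mulr_natl//; lra.
  by rewrite -ler_ln ?posrE ?expR_gt0// expRK lnU; nra.
have UY' : U <= eta / 2 * Y.
  apply: (le_trans UE); rewrite mulrBl mul1r expRB ler_pdivrMr ?expR_gt0//.
  apply: (le_trans lY).
  have : Y * 2 <= Y * (eta * expR (eta * l)) by rewrite ler_pM2l.
  lra.
have UY : U <= Y by nra.
have aU : a * U <= eta / 2.
  apply: (@le_trans _ _ (a * expR ((1 - eta) * l))); first by rewrite ler_pM2l.
  rewrite aE -expRD (_ : - l + _ = - (eta * l)); last by ring.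
  by rewrite expRN -div1r ler_pdivrMr ?expR_gt0//; lra.
exists U; split => //=.
have [up lo] := mass_sum K (ltW a0) L1 (ltac:(lra) : 7 <= l) lam1.
rewrite -UdE in up lo.
have H0 : 0 < L `^ (- (2 * a)) by rewrite powR_gt0//; lra.
have lnl0 : 0 <= ln l by rewrite ln_ge0//; lra.
split; last first.
  apply: (le_trans up).
  rewrite (_ : _ * (_ / _ * _) = (K%:R * (1 + eta) / ln L) * L `^ (- (2 * a))); last by ring.
  rewrite [leRHS](_ : _ = (2 * l / ln (1 + eta) / Y) * L `^ (- (2 * a))); last by ring.
  rewrite ler_pM2r// lnL ler_pM ?mulr_ge0 ?invr_ge0//; [by rewrite addr_ge0// ltW|by rewrite addr_ge0// ltW| |].
    rewrite ler_pdivlMr//.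
    have : K%:R * ln (1 + eta) <= l.
      have := ler_wpM2r (ltW lnlam) Kr; rewrite rE.
      by have := mulr_gt0 e0 l0; move: lnl0; clear; lra.
    by move: e0 e40 l0; clear; nra.
  by rewrite lef_pV2 ?posrE ?ltr_wpDr// lerDl.
have il : 7 / l <= eta ^+ 2 by rewrite ler_pdivrMr.
have ilam : (1 + eta)^-1 <= 1 - eta + eta ^+ 2.
  rewrite -div1r ler_pdivrMr; last by rewrite (lt_trans ltr01).
  by move: e0; clear; nra.
apply: le_trans (lo _); last by move: il ilam e0 e40; clear; nra.
(* Four losses, a factor [kap] each: the decay of [p^(-2a)], [ln L + U] against [Y], the number of
   blocks, and the Mertens error within a block. *)
have expU : kap <= expR (- (2 * a * U)).
  by have := expR_ge1Dx (- (2 * a * U)); rewrite kapE; lra.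
have denU : kap / Y <= (ln L + U)^-1.
  rewrite -[leRHS]div1r ler_pdivlMr; last by rewrite lnL; lra.
  rewrite mulrAC ler_pdivrMr// mul1r lnL.
  have : Y + ln Y + U <= (1 + eta) * Y by move: Y1 UY' e0 Y0; clear; nra.
  have k0 : 0 <= kap by rewrite kapE; move: e40; clear; lra.
  move=> /(ler_wpM2l k0); rewrite kapE; move: e0 Y0; clear; nra.
have Kl : kap * l <= K%:R * eta.
  have : kap * l <= K%:R * ln (1 + eta).
    have := ler_wpM2r (ltW lnlam) (ltW rK); rewrite rE kapE.
    by move: l2; clear; lra.
  by have : 0 <= (K%:R : R) by []; move: lnlame; clear; nra.
have k0 : 0 < kap by rewrite kapE; move: e40; clear; lra.
have m1 : eta * kap <= 1 - (1 + eta)^-1 - 7 / l by rewrite kapE; move: il ilam; clear; lra.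
have m2 : kap * kap / Y <= expR (- (2 * a * U)) / (ln L + U).
  rewrite -mulrA; apply: ler_pM => //; first exact: ltW.
  by rewrite divr_ge0// ltW.
rewrite [leLHS](_ : _ = (kap * l) * kap * (kap * kap / Y) * L `^ (- (2 * a))); last by ring.
rewrite [leRHS](_ : _ = (K%:R * (1 - (1 + eta)^-1 - 7 / l)) *
   (expR (- (2 * a * U)) / (ln L + U)) * L `^ (- (2 * a))); last by ring.
rewrite ler_pM2r//; apply: ler_pM => //.
- by rewrite !mulr_ge0// ltW.
- by rewrite divr_ge0 ?mulr_ge0// ltW.
- apply: (@le_trans _ _ (K%:R * eta * kap)); first by rewrite ler_pM2r.
  by rewrite -mulrA ler_wpM2l.
Qed.

(** * Choice of the weight *)

(** By concavity, [ln] lies below its tangent at [l], whose slope [1 / l] is at most [k]. *)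
Lemma ln_le_slope (R : realType) (k l x : R) :
  0 < l -> 1 <= k * l -> ln l <= k * l -> l <= x -> ln x <= k * x.
Proof.
move=> l0 kl1 kl lx; have x0 : 0 < x by lra.
have xl : 1 <= x / l by rewrite ler_pdivlMr// mul1r.
have := @le_ln1Dx R (x / l - 1) (ltac:(lra)).
rewrite (_ : 1 + _ = x / l); last by ring.
rewrite ln_div ?posrE// => H.
have -> : k * x = k * l * (x / l) by field; rewrite gt_eqF.
nra.
Qed.

(** [G0] will be the sum of the [f w]. Of the power [kap ^+ 8], one half comes from the lower bound
    for the mass [A] and the other from the reduced budget [c A = kap^4 X / 2]. *)
Lemma Gal_ge_large (R : realType) (eta l Y : R) (N : nat) : 0 < eta <= 1 / 40 ->
  large eta l -> large eta Y -> expR l <= Y -> (0 < N)%N ->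
  ln (N%:R : R) = expR Y ->
  let a := expR (- l) in
  let L := expR Y * Y in
  exists G0, [/\ 0 <= G0,
    (1 - 2 * eta) ^+ 8 * (l * (expR Y / Y * L `^ (- (2 * a)))) <= 2 * G0 ^+ 2 &
    ((expR ((1 - eta) * (4 * G0)) / (4 * expR 1 * (expR Y + 1) ^+ 2))%:E
       <= Gal (1 / 2 + a) N)%E].
Proof.
move=> eta01 lgl lgY lY N0 lnN a L.
have [U [lU UY /= [Alo Aup]]] := mass_bounds eta01 lgl lgY lY.
rewrite -/a -/L in Alo Aup.
set n1 := (block_end L l).+1 in Alo Aup; set n2 := (block_end L U).+1 in Alo Aup.
set A := \sum_(_ <= _ < _ | _) _ in Alo Aup.
set kap := 1 - 2 * eta in Alo *.
case/andP: eta01 => e0 e40.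
case: lgl => -[l8 l7 _ _ l4] [[l5 l6 l9] _].
case: lgY => -[Y8 _ _ _ _] [_ [Y2 Y3 _]].
have aE : a = expR (- l) by []. have LE : L = expR Y * Y by [].
have kapE : kap = 1 - 2 * eta by [].
rewrite -/kap in l5.
clearbody a L kap.
have k0 : 0 < kap by lra.
have l0 : 0 < l by lra.
have Y0 : 0 < Y by lra.
have U0 : 0 < U by lra.
have eY := expR_gt0 Y; set X := expR Y in eY LE lnN Y3 *.
have a0 : 0 < a by rewrite aE expR_gt0.
have ael : a * expR l = 1 by rewrite aE -expRD addNr expR0.
have a8 : 8 * a <= eta.
  by have := ler_wpM2l (ltW a0) l4; rewrite mulrCA ael; lra.
have lnlam : 0 < ln (1 + eta) by rewrite ln_gt0//; lra.
have L1 : 1 < L.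
  by have := expR_ge1Dx Y; rewrite -/X LE => X1; nra.
have L0 : 0 < L by lra.
set H := L `^ (- (2 * a)) in Alo Aup *.
have H0 : 0 < H by rewrite powR_gt0.
have HY0 : 0 < H / Y by rewrite divr_gt0.
have k40 : 0 < kap ^+ 4 by rewrite exprn_gt0.
have A0 : 0 < A.
  by apply: lt_le_trans Alo; apply: mulr_gt0 => //; exact: mulr_gt0.
have H1 : H <= 1.
  rewrite /H /powR gt_eqF// -[leRHS](@expR0 R) ler_expR mulNr oppr_le0.
  by rewrite !mulr_ge0 ?ln_ge0// ltW.
have A1 : A <= 1.
  apply: (le_trans Aup); rewrite mulrA ler_pdivrMr// mul1r.
  apply: le_trans lY; apply: (@le_trans _ _ (2 * l / ln (1 + eta) * 1)).
    by rewrite ler_wpM2l// divr_ge0 ?mulr_ge0// ltW.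
  by rewrite mulr1 ler_pdivrMr// [leRHS]mulrC.
(* As [2g] is about [u] and [f^2 = c mass / u], the entropy is about [2 c A]. It is set to
   [kap^4 ln N], slightly below the budget, to leave room for the error terms. *)
have [c cE] : exists c, c = kap ^+ 4 * X / (2 * A) by eexists.
have c0 : 0 < c by rewrite cE divr_gt0 ?mulr_gt0.
have cA : c * A = kap ^+ 4 * X / 2.
  by rewrite cE; field; rewrite gt_eqF.
(* [D = L^(1 + 2a) / c] is the constant in [2g = ln D + (1 + 2a) u + 2 ln u]. The choice of [L]
   makes it lie between 1 and [e^(eta l / 3)], which forces [u <= 2g <= (1 + eta) u]. *)
have [D DE] : exists D, D = 2 * Y * A / (H * kap ^+ 4) by eexists.
have D0 : 0 < D by rewrite DE divr_gt0 ?mulr_gt0 ?mulr_gt0.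
have lnD : ln D = (1 + 2 * a) * ln L - ln c.
  have -> : D = (L * H^-1) / c.
    by rewrite DE cE LE; field; rewrite !gt_eqF.
  rewrite ln_div ?posrE// ?divr_gt0// ln_div ?posrE// /H ln_powR; ring.
have D1 : 0 <= ln D.
  rewrite ln_ge0// DE ler_pdivlMr ?mulr_gt0// mul1r.
  have := ler_wpM2l (ltW Y0) Alo.
  rewrite (_ : Y * _ = l * (H * kap ^+ 4)); last by field; rewrite gt_eqF.
  have : 0 < H * kap ^+ 4 by rewrite mulr_gt0.
  nra.
have D2 : ln D <= eta / 3 * l.
  apply: le_trans l5; rewrite -lnM ?posrE ?divr_gt0 ?mulr_gt0//.
  rewrite ler_ln ?posrE ?mulr_gt0 ?invr_gt0 ?mulr_gt0// DE ler_pdivrMr ?mulr_gt0//.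
  have := ler_wpM2l (ltW Y0) Aup.
  rewrite [leRHS](_ : _ = 2 * l / ln (1 + eta) * H); last by field; rewrite !gt_eqF.
  move=> YA; rewrite [leRHS](_ : _ = 2 * (2 * l / ln (1 + eta) * H)).
    by lra.
  by field; rewrite !gt_eqF.
pose P := [seq p <- index_iota n1 n2 | prime p].
pose p (i : 'I_(size P)) := tnth (in_tuple P) i.
have sumP (F : nat -> R) : \sum_i F (p i) = \sum_(n1 <= q < n2 | prime q) F q.
  by rewrite -[RHS]big_filter big_tnth.
have pI : injective p by apply/tuple_uniqP; rewrite filter_uniq// iota_uniq.
have pin i : p i \in P by rewrite mem_tnth.
have pP i : prime (p i) by have := pin i; rewrite mem_filter => /andP[].
pose u (q : nat) := ln (q%:R : R) - ln L.
have puU i : l < u (p i) <= U.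
  have := pin i; rewrite mem_filter mem_index_iota => /andP[_ pb].
  exact: block_endP L0 pb.
pose sg := 1 / 2 + a.
pose g (q : nat) := - ln c / 2 + sg * ln q%:R + ln (u q).
pose w (q : nat) := (q%:R : R) `^ (- sg).
have p0 i : 0 < ((p i)%:R : R) by rewrite ltr0n prime_gt0.
have u0 i : 0 < u (p i) by have /andP[lu _] := puU i; exact: lt_trans lu.
have wE i : w (p i) = expR (- sg * ln (p i)%:R) by rewrite /w /powR gt_eqF.
have massE i : prime_mass a L (p i) = expR (- (1 + 2 * a) * ln (p i)%:R - ln (u (p i))).
  by rewrite /prime_mass -/(u _) /powR (gt_eqF (p0 i)) expRB lnK ?posrE.
have [sc scE] : exists sc, sc = expR (ln c / 2) by eexists.
have scc : sc ^+ 2 = c by rewrite scE -expRM_natl mulrC divfK ?lnK ?posrE.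
have fwE i : expR (- g (p i)) * w (p i) = sc * prime_mass a L (p i).
  by rewrite wE massE scE -!expRD; congr expR; rewrite /g /sg; field.
have f2E i : expR (- g (p i)) ^+ 2 = c * prime_mass a L (p i) / u (p i).
  rewrite massE -[in RHS](lnK (_ : u (p i) \is Num.pos)) ?posrE//.
  rewrite expRK -{1}[c]lnK ?posrE// -expRN -!expRD -expRM_natl; congr expR.
  by rewrite /g /sg; field.
have gE i : 2 * g (p i) = ln D + (1 + 2 * a) * u (p i) + 2 * ln (u (p i)).
  by rewrite lnD /g /u /sg; field.
have g_lo i : u (p i) <= 2 * g (p i).
  have /andP[lu _] := puU i.
  have : 0 <= ln (u (p i)) by rewrite ln_ge0//; move: lu l8; clear; lra.
  have : 0 <= a * u (p i) by rewrite mulr_ge0// ltW.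
  by rewrite gE; move: D1; clear; lra.
have el6 : 1 <= eta / 6 * l by move: l7 e0 e40 l8; clear; nra.
have near6 x : l <= x -> 2 * ln x <= eta / 3 * x.
  by move=> lx; have := ln_le_slope l0 el6 l6 lx; clear; lra.
have g_up i : 2 * g (p i) <= (1 + eta) * u (p i).
  have /andP[lu _] := puU i; have ui := u0 i.
  have h1 : ln D <= eta / 3 * u (p i) by move: D2 lu e0; clear; nra.
  have h2 := near6 _ (ltW lu).
  have h3 : 2 * a * u (p i) <= eta / 3 * u (p i) by rewrite ler_pM2r//; move: a8 e0; clear; lra.
  by rewrite gE; move: h1 h2 h3; clear; lra.
have el_a i : expR (- u (p i)) <= a.
  by have /andP[lu _] := puU i; rewrite aE ler_expR lerN2 ltW.
have f2_small i : expR (- g (p i)) ^+ 2 <= a.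
  apply: le_trans (el_a i); rewrite -expRM_natl ler_expR; have := g_lo i; clear; lra.
have w2_small i : w (p i) ^+ 2 <= a.
  apply: le_trans (el_a i); rewrite wE -expRM_natl ler_expR /sg.
  have lnL0 : 0 < ln L by rewrite ln_gt0.
  have : u (p i) <= ln (p i)%:R by rewrite /u lerBlDr lerDl ltW.
  have := u0 i; move: a0; clear; nra.
have fw0 i : 0 < expR (- g (p i)) * w (p i).
  by rewrite mulr_gt0 ?expR_gt0// wE expR_gt0.
have sc0 : 0 < sc by rewrite scE expR_gt0.
have sumfw : \sum_i expR (- g (p i)) * w (p i) = sc * A.
  by under eq_bigr => i _ do rewrite fwE; rewrite -mulr_sumr sumP.
have mass0 i : 0 < prime_mass a L (p i) by rewrite massE expR_gt0.
exists (sc * A); split; first by rewrite mulr_ge0// ltW.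
  rewrite exprMn scc [_ ^+ 2]expr2 [c * _]mulrA cA.
  rewrite (_ : 2 * _ = kap ^+ 4 * X * A); last by field.
  have := ler_wpM2l (ltW (mulr_gt0 k40 eY)) Alo; apply: le_trans.
  by rewrite le_eqVlt; apply/orP; left; apply/eqP; ring.
(* [g <= Y] on the whole range, so [s = eta / (2 Y)] gives [2sg <= eta], while [ln 4 / s] is only of
   order [Y]. *)
have := @Gal_ge_exp R sg 'I_(size P) p (fun i => expR (- g (p i))) (fun i => g (p i))
  (eta / (2 * Y)) eta N pI pP; rewrite /= sumfw lnN; apply.
- by rewrite addr_gt0// divr_gt0.
- by [].
- by rewrite divr_gt0// mulr_gt0.
- by rewrite e0 (le_trans e40)// ler_pM2l// lef_pV2 ?posrE// ler_nat.
- by [].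
- by move=> i; have := g_lo i; have := u0 i; clear; lra.
- move=> i; rewrite (_ : _ * _ = eta * (g (p i) / Y)); last by field; rewrite gt_eqF.
  rewrite -[leRHS]mulr1 ler_pM2l// ler_pdivrMr// mul1r.
  have /andP[_ uU] := puU i; have := g_up i; have := u0 i; move: uU UY e40; clear; nra.
- move=> i; rewrite -/(w (p i)).
  have := f2_small i; have := w2_small i; have := fw0 i.
  have := sqr_ge0 (expR (- g (p i)) - w (p i)).
  set f := expR _; set v := w _ => h1 h2 h3 h4.
  have h5 : f * v <= a by move: h1 h3 h4; clear; nra.
  have h6 : (f * v) ^+ 2 <= f * v by move: h2 h5 a8 e40; clear; nra.
  move: h4 h5 h6 a8; clear; lra.
have cost1 : \sum_i 4 * (1 + 2 * eta) * g (p i) *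
    (expR (- g (p i)) * (p i)%:R `^ (- sg) + expR (- g (p i)) ^+ 2 * (1 + (p i)%:R `^ (- sg) ^+ 2)) <=
    8 * Y * (sc * A) + 2 * (1 + 2 * eta) ^+ 3 * (c * A).
  rewrite -[A]sumP !mulr_sumr -big_split/=; apply: ler_sum => i _.
  rewrite -/(w (p i)) mulrDr; apply: lerD.
    rewrite fwE; apply: ler_wpM2r; first by rewrite mulr_ge0// ltW.
    have /andP[_ uU] := puU i; have := g_up i; have := g_lo i; have := u0 i; move: uU UY e0 e40; clear; nra.
  rewrite f2E.
  rewrite [leLHS](_ : _ = 2 * (1 + 2 * eta) * (2 * g (p i) / u (p i)) * (1 + w (p i) ^+ 2) *
     (c * prime_mass a L (p i))); last by field; rewrite gt_eqF.
  apply: ler_wpM2r; first by rewrite mulr_ge0// ltW.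
  have h1 : 2 * g (p i) / u (p i) <= 1 + eta by rewrite ler_pdivrMr.
  have h2 : 0 <= 2 * g (p i) / u (p i).
    by rewrite divr_ge0 ?(ltW (u0 i))//; have := g_lo i; have := u0 i; clear; lra.
  have h3 := w2_small i; have h4 := sqr_ge0 (w (p i)).
  have h5 : 2 * g (p i) / u (p i) * (1 + w (p i) ^+ 2) <= (1 + 2 * eta) * (1 + 2 * eta).
    by apply: ler_pM => //; move: h1 h3 h4 a8 e0; clear; lra.
  by move: h5 e0; clear; nra.
have cost2 : \sum_i 2 * expR (- g (p i)) ^+ 2 <= 2 / l * (c * A).
  rewrite -[A]sumP !mulr_sumr; apply: ler_sum => i _; rewrite f2E.
  have /andP[lu _] := puU i.
  rewrite [leLHS](_ : _ = 2 / u (p i) * (c * prime_mass a L (p i))); last by field; rewrite gt_eqF.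
  apply: ler_wpM2r; first by rewrite mulr_ge0// ltW.
  by rewrite ler_pM2l// lef_pV2 ?posrE// ltW.
apply: le_trans (lerD (lerD cost1 cost2) (lexx _)) _.
have k1 : kap <= 1 by rewrite kapE lerBlDr lerDl mulr_ge0// ltW.
have k41 : kap ^+ 4 <= 1 by rewrite exprn_ile1// ltW.
have X12 : expR (1 / 2 * Y) ^+ 2 = X.
  by rewrite -expRM_natl /X; congr expR; field.
have scA : sc * A <= expR (1 / 2 * Y).
  rewrite -(@ler_pXn2r _ 2) ?nnegrE ?mulr_ge0 ?expR_ge0 ?(ltW A0) ?(ltW sc0)//.
  rewrite X12 exprMn scc expr2 mulrA cA.
  have kA : kap ^+ 4 * A <= 1 by rewrite mulr_ile1 ?(ltW k40) ?(ltW A0).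
  by move: kA eY (mulr_gt0 k40 A0); clear; nra.
(* The four costs take shares [eta / 2], [1 - 2 eta], [eta / 2] and [eta] of [X], with sum exactly
   1. In [t2] three of the factors [kap] of [c A] cancel [(1 + 2 eta)^3]. *)
have t1 : 8 * Y * (sc * A) <= eta / 2 * X.
  have : 8 * Y * (sc * A) <= 8 * Y * expR (1 / 2 * Y).
    by apply: ler_wpM2l scA; apply: mulr_ge0 => //; exact: ltW.
  move=> /le_trans; apply; rewrite -X12 expr2 mulrA ler_pM2r ?expR_gt0//.
  by move: Y2; rewrite mulrAC ler_pdivrMr//; clear; lra.
have t2 : 2 * (1 + 2 * eta) ^+ 3 * (c * A) <= kap * X.
  rewrite cA (_ : _ * (_ / 2) = ((1 + 2 * eta) * kap) ^+ 3 * (kap * X)); last by field.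
  rewrite ler_piMl ?mulr_ge0 ?(ltW k0) ?(ltW eY)//.
  by rewrite exprn_ile1// kapE; move: e0 e40; clear; nra.
have t3 : 2 / l * (c * A) <= eta / 2 * X.
  rewrite cA (_ : 2 / l * _ = kap ^+ 4 / l * X); last by field; rewrite gt_eqF.
  by rewrite ler_pM2r// ler_pdivrMr//; move: k41 l7 e0 e40 l8; clear; nra.
have t4 : ln 4 / (eta / (2 * Y)) <= eta * X.
  have l4' : ln (4 : R) <= 2.
    rewrite (_ : 4 = 2 * 2 :> R); last by ring.
    by rewrite lnM ?posrE//; have := @ln2_le1 R; lra.
  rewrite (_ : _ / _ = ln 4 * 2 * Y / eta); last by field; rewrite !gt_eqF.
  rewrite ler_pdivrMr//; move: Y3; rewrite mulrAC ler_pdivrMr ?exprn_gt0//; move: l4' Y0 e0 eY; clear; nra.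
rewrite kapE in t2; move: t1 t2 t3 t4; clear; lra.
Qed.

(* [X] and [Y] stand for [ln N] and [loglog N], and [l] for [- ln a]. *)
Lemma exponent_compare (R : realType) (eta eps l Y a G0 : R) :
  0 < eta <= 1 / 40 -> 28 * eta <= eps -> large eta Y -> 1 <= l ->
  0 <= a <= 1 / 8 -> 0 <= G0 ->
  (1 - 2 * eta) ^+ 8 *
    (l * (expR Y / Y * (expR Y * Y) `^ (- (2 * a)))) <= 2 * G0 ^+ 2 ->
  (2 * Num.sqrt 2 - eps) * Num.sqrt l *
    (expR Y `^ (1 - (1 / 2 + a)) / Y `^ (1 / 2 + a)) + (2 * Y + 5) <=
  (1 - eta) * (4 * G0).
Proof.
move=> /andP[e0 e40] eps28 [[Y8 _ _ _ _] [_ [_ _ Y4]]] l1 /andP[a0 a8] G00 HG.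
have Y0 : 0 < Y by rewrite (lt_le_trans _ Y8).
have l0 : 0 <= l by rewrite (le_trans _ l1).
have VE : expR Y `^ (1 - (1 / 2 + a)) / Y `^ (1 / 2 + a) =
    expR ((1 / 2 - a) * Y - (1 / 2 + a) * ln Y).
  by rewrite /powR (gt_eqF Y0) gt_eqF ?expR_gt0// expRK -expRB; congr expR; field.
have V2E : expR Y / Y * (expR Y * Y) `^ (- (2 * a)) =
    expR ((1 / 2 - a) * Y - (1 / 2 + a) * ln Y) ^+ 2.
  rewrite /powR gt_eqF ?mulr_gt0 ?expR_gt0// lnM ?posrE ?expR_gt0// expRK.
  rewrite -[X in _ / X * _](lnK (_ : Y \is Num.pos)) ?posrE//.
  by rewrite -expRB -expRD -expRM_natl; congr expR; field.
rewrite V2E in HG; rewrite VE -mulrA.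
set V := expR _ in HG *; have V0 : 0 < V by exact: expR_gt0.
have lnY : ln Y <= Y by rewrite ltW ?ln_sublinear.
have lnY0 : 0 <= ln Y by rewrite ln_ge0// (le_trans _ Y8)// ler1n.
have V2 : expR (1 / 2 * Y) / Y <= V ^+ 2.
  rewrite -[X in _ / X <= _](lnK (_ : Y \is Num.pos)) ?posrE//.
  rewrite -expRB -expRM_natl ler_expR.
  by move: lnY lnY0 a0 a8 Y0; clear; nra.
clearbody V; set t := Num.sqrt l * V.
have t0 : 0 <= t by rewrite mulr_ge0 ?sqrtr_ge0 ?(ltW V0).
have t2 : t ^+ 2 = l * V ^+ 2 by rewrite exprMn sqr_sqrtr.
clearbody t; rewrite -t2 in HG.
have k0 : 0 <= 1 - 2 * eta by move: e40; clear; lra.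
set s2 := Num.sqrt 2; have s20 : 0 <= s2 by exact: sqrtr_ge0.
have s22 : s2 ^+ 2 = 2 by rewrite sqr_sqrtr.
have main : (1 - 2 * eta) ^+ 4 * t <= s2 * G0.
  rewrite -(@ler_pXn2r _ 2) ?nnegrE ?mulr_ge0 ?exprn_ge0//.
  by rewrite [leLHS]exprMn [leRHS]exprMn s22 -exprM.
have k4 : 1 - 9 * eta <= (1 - eta) * (1 - 2 * eta) ^+ 4.
  have k2 : 1 - 4 * eta <= (1 - 2 * eta) ^+ 2 by move: (sqr_ge0 eta); clear; lra.
  have k4 : 1 - 8 * eta <= (1 - 2 * eta) ^+ 4.
    rewrite (_ : 4 = 2 * 2)%N// exprM; move: k2 e0 e40; clear.
    by set k := (_ - 2 * _) ^+ 2; nra.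
  by move: k4 e0 e40; clear; set k := _ ^+ 4; nra.
have s23 : s2 <= 3 / 2 by move: s22 s20; clear; nra.
have Yt : 2 * Y + 5 <= eta * t.
  rewrite -(@ler_pXn2r _ 2) ?nnegrE ?addr_ge0 ?mulr_ge0 ?(ltW Y0) ?(ltW e0)//.
  rewrite exprMn t2.
  have V2l : V ^+ 2 <= l * V ^+ 2 by rewrite ler_peMl ?sqr_ge0.
  apply: (@le_trans _ _ (eta ^+ 2 * (expR (1 / 2 * Y) / Y))); last first.
    by rewrite ler_wpM2l ?sqr_ge0// (le_trans V2).
  rewrite mulrA ler_pdivlMr//.
  apply: (@le_trans _ _ (49 * Y ^+ 3)).
    rewrite [X in _ <= 49 * X]exprSr mulrA ler_wpM2r ?(ltW Y0)//.
    by move: Y8; clear; nra.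
  by move: Y4; rewrite mulrAC ler_pdivrMr ?exprn_gt0// [X in _ <= X]mulrC.
have H1 : 2 * s2 * ((1 - eta) * ((1 - 2 * eta) ^+ 4 * t)) <= (1 - eta) * (4 * G0).
  rewrite [leRHS](_ : _ = 2 * s2 * ((1 - eta) * (s2 * G0))); last first.
    rewrite [RHS](_ : _ = (1 - eta) * (2 * s2 ^+ 2 * G0)); last by ring.
    by rewrite s22; ring.
  rewrite ler_wpM2l ?mulr_ge0// ler_wpM2l//.
  by move: e40; clear; lra.
apply: le_trans H1.
have H2 : (1 - 9 * eta) * t <= (1 - eta) * ((1 - 2 * eta) ^+ 4 * t).
  by rewrite mulrA ler_wpM2r.
have H3 : 2 * s2 * ((1 - 9 * eta) * t) <=
   2 * s2 * ((1 - eta) * ((1 - 2 * eta) ^+ 4 * t)).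
  by rewrite ler_wpM2l ?mulr_ge0.
apply: le_trans H3.
have H4 : s2 * (eta * t) <= 3 / 2 * (eta * t).
  by rewrite ler_wpM2r// mulr_ge0// ltW.
(* The factor [1 - 9 eta] loses [18 sqrt 2 eta <= 27 eta], and the polylogarithmic term [2 Y + 5]
   takes one more [eta]. *)
have H5 : 28 * eta * t <= eps * t by rewrite ler_wpM2r.
by move: Yt H4 H5; clear; lra.
Qed.

(** With [X = e^Y >= 1], [(X + 1)^2 <= 4 X^2], and [16 <= e^4] absorbs the constants. *)
Lemma polylog_le (R : realType) (Y : R) : 0 <= Y ->
  4 * expR 1 * (expR Y + 1) ^+ 2 <= expR (2 * Y + 5).
Proof.
move=> Y0; have e2 : 2 <= expR (1 : R) by have := @expR_ge1Dx R 1; lra.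
have Y1 : 1 <= expR Y by rewrite -[leLHS]expR0 ler_expR.
have -> : expR (2 * Y + 5) = expR 1 ^+ 4 * expR 1 * expR Y ^+ 2.
  by rewrite -!expRM_natl -!expRD; congr expR; ring.
have e4 : 16 <= expR (1 : R) ^+ 4.
  rewrite (_ : 16 = 2 ^+ 4 :> R); last by ring.
  by rewrite lerXn2r ?nnegrE ?expR_ge0.
have X4 : (expR Y + 1) ^+ 2 <= 4 * expR Y ^+ 2 by move: Y1; clear; nra.
apply: (@le_trans _ _ (4 * expR 1 * (4 * expR Y ^+ 2))).
  by rewrite ler_wpM2l// mulr_ge0 ?expR_ge0.
rewrite [leLHS](_ : _ = 16 * expR 1 * expR Y ^+ 2); last by ring.
by rewrite ler_wpM2r ?sqr_ge0// ler_wpM2r ?expR_ge0.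
Qed.

Theorem theorem1p2 (R : realType) (eps : R) (heps : 0 < eps) :
  exists2 delta : R, 0 < delta &
    forall (N : nat) (sigma : R),
      (0 < N)%N -> 0 < loglog (N%:R : R) ->
      1 / 2 + 1 / loglog (N%:R : R) <= sigma -> sigma <= 1 / 2 + delta ->
      ((expR ((2 * Num.sqrt 2 - eps)
              * Num.sqrt `|ln (sigma - 1 / 2)|
              * (ln (N%:R : R) `^ (1 - sigma)
                 / loglog (N%:R : R) `^ sigma)))%:E
       <= Gal sigma N)%E.
Proof.
have [eta [e0 e40 eps28]] : exists eta : R, [/\ 0 < eta, eta <= 1 / 40 & 28 * eta <= eps].
  exists (Num.min eps 1 / 40); split.
  - by rewrite divr_gt0// lt_min heps ltr01.
  - by rewrite ler_pM2r ?invr_gt0// ge_min lexx orbT.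
  - have : Num.min eps 1 <= eps by rewrite ge_min lexx.
    by move: heps; clear; lra.
have [M [_ HM]] := near_large e0.
(* This forces [l >= |M| + 2 > M], and then also [Y >= e^l > M], so both are [large]. *)
exists (expR (- (`|M| + 2))); first exact: expR_gt0.
move=> N sigma N0 Y0 sig_lo sig_up.
set Y := loglog N%:R in Y0 sig_lo *.
(* [ln] is 0 at nonpositive arguments, so [loglog N > 0] does imply [ln N > 0]. *)
have lnN : ln (N%:R : R) = expR Y.
  rewrite /Y /loglog lnK// posrE ltNge; apply/negP => lnN_le0.
  by move: Y0; rewrite /Y /loglog ln0// ltxx.
have a0 : 0 < sigma - 1 / 2.
  rewrite subr_gt0 (lt_le_trans _ sig_lo)// ltrDl divr_gt0//.
set l := - ln (sigma - 1 / 2).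
have aE : sigma - 1 / 2 = expR (- l) by rewrite opprK lnK ?posrE.
have lM : `|M| + 2 <= l.
  by rewrite -lerN2 -ler_expR -aE lerBlDl.
have M0 := normr_ge0 M; have leM := ler_norm M.
(* This is the hypothesis [sigma >= 1/2 + 1 / loglog N] rewritten in terms of [l]. *)
have lY : expR l <= Y.
  have : Y^-1 <= sigma - 1 / 2 by rewrite lerBrDl -[Y^-1]div1r.
  by rewrite aE expRN lef_pV2 ?posrE ?expR_gt0.
have lgl : large eta l by apply: HM; move: lM leM; clear; lra.
have lgY : large eta Y.
  by apply: HM; have := expR_ge1Dx l; move: lM leM lY; clear; lra.
have l1 : 1 <= l by move: lM M0; clear; lra.
have l0 : 0 <= l by rewrite (le_trans _ l1).
have [G0 [G00 G0lo Glo]] := Gal_ge_large (introT andP (conj e0 e40)) lgl lgY lY N0 lnN.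
have sigE : sigma = 1 / 2 + expR (- l) by rewrite -aE addrC subrK.
rewrite -sigE in Glo; apply: le_trans Glo; rewrite lee_fin.
have -> : `|ln (sigma - 1 / 2)| = l by rewrite aE expRK normrN ger0_norm.
rewrite ler_pdivlMr; last by rewrite mulr_gt0 ?exprn_gt0 ?mulr_gt0 ?addr_gt0 ?expR_gt0.
apply: (@le_trans _ _ (expR ((2 * Num.sqrt 2 - eps) * Num.sqrt l *
    (ln N%:R `^ (1 - sigma) / Y `^ sigma)) * expR (2 * Y + 5))).
  by rewrite ler_wpM2l ?expR_ge0// polylog_le// ltW.
rewrite -expRD ler_expR lnN sigE.
apply: exponent_compare => //; first by rewrite e0.
rewrite expR_ge0/=; case: lgl => -[_ _ _ _ e8] _.
move: e8; rewrite -[expR l]opprK; have := expR_gt0 l; rewrite opprK expRN.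
move=> el0 e8; rewrite -div1r ler_pdivrMr//; move: e8 e40 el0; clear; nra.
Qed.
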